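(* Let $n\ge 1$ and consider the magnetic system $(\mathbb S^{2n+1},g,\mathrm d\alpha)$, where $g$ is the round metric and $\alpha$ the standard contact form. Its Mañé critical value is \[ c(\mathbb S^{2n+1},g,\mathrm d\alpha)=\tfrac12\Vert\alpha\Vert_\infty^2=\tfrac18, \] and its Mather set is \[ \widetilde{\mathcal M}=\{(z,\tfrac14R_z)\mid z\in\mathbb S^{2n+1}\}\subset T\mathbb S^{2n+1}. \] Let $q_0,q_1\in\mathbb S^{2n+1}$ and, for $k>0$, let $\mathcal G_k(q_0,q_1)$ be the set of magnetic geodesics of $(\mathbb S^{2n+1},g,\mathrm d\alpha)$ with energy $k$ connecting $q_0$ and $q_1$. Then: \begin{enumerate} \item if $k>\tfrac18$, then $\mathcal G_k(q_0,q_1)\neq\varnothing$; \item if $k=\tfrac18$, then $\mathcal G_k(q_0,q_1)\neq\varnothing$ if and only if $\langle q_0,q_1\rangle\neq0$; \item if $0<k<\tfrac18$, then: \begin{enumerate} \item if $|\langle q_0,q_1\rangle|>\sqrt{1-8k}$, then $\mathcal G_k(q_0,q_1)\neq\varnothing$; \item there are $a_k,b_k\in\mathbb R$ with $b_k>0$, depending only on $k$, such that, if $|\langle q_0,q_1\rangle|=\sqrt{1-8k}$, then $\mathcal G_k(q_0,q_1)\neq\varnothing$ if and only if $\langle q_0,q_1\rangle=e^{\mathrm i(a_k+mb_k)}\sqrt{1-8k}$ for some $m\in\mathbb Z$; \item if $|\langle q_0,q_1\rangle|<\sqrt{1-8k}$, then $\mathcal G_k(q_0,q_1)=\varnothing$.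 \end{enumerate} \end{enumerate}
   Context: $\mathbb S^{2n+1}$ is the unit sphere in $\mathbb C^{n+1}$ with standard Hermitian product $\langle\cdot,\cdot\rangle$; $g=\mathrm{Re}\langle\cdot,\cdot\rangle$ restricted to $\mathbb S^{2n+1}$; $\alpha_z=\tfrac12\mathrm{Re}\langle \mathrm iz,\cdot\rangle$; its Reeb vector field is $R_z=2\mathrm iz$. A magnetic system $(M,g,\sigma)$ is a closed connected Riemannian manifold $(M,g)$ with a closed two-form $\sigma$. The Lorentz force $Y:TM\to TM$ is defined by $g_q(Y_qu,v)=\sigma_q(u,v)$. A smooth curve $\gamma:\mathbb R\to M$ is a magnetic geodesic if $\nabla_{\dot\gamma}\dot\gamma=Y_\gamma\dot\gamma$, with $\nabla$ the Levi-Civita connection of $g$; its (constant) energy is $\tfrac12g(\dot\gamma,\dot\gamma)$. A magnetic geodesic $\gamma:\mathbb R\to M$ connects $q_0$ and $q_1$ if $\gamma(-\tfrac T2)=q_0$ and $\gamma(\tfrac T2)=q_1$ for some $T\in\mathbb R$, up to a shift of time (i.e. both points lie on the image of $\gamma$). If the lift $\hat\sigma$ of $\sigma$ to the universal cover $\hat M$ is exact, the Mañé critical value is $c(M,g,\sigma)=\inf_{\mathrm d\hat\alpha=\hat\sigma}\tfrac12\Vert\hat\alpha\Vert_\infty^2$, the infimum over all primitives $\hat\alpha$ of $\hat\sigma$, where $\Vert\cdot\Vert_\infty$ is the supremum over $\hat M$ of the pointwise norm with respect to the lifted metric. The Mather set $\widetilde{\mathcal M}\subset TM$ of $(M,g,\mathrm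 d\alpha)$ is the union of the supports of all Borel probability measures $\mu$ on $TM$ that are invariant under the magnetic geodesic flow $(\gamma(0),\dot\gamma(0))\mapsto(\gamma(t),\dot\gamma(t))$ and that minimize $\int_{TM}L\,\mathrm d\mu$ among all such invariant measures, where $L(q,v)=\tfrac12|v|_q^2-\alpha_q(v)$. *)

(* Defs.v *)
From HB Require Import structures.
From mathcomp Require Import all_boot all_order all_algebra.
From mathcomp Require Import complex.
From mathcomp Require Import all_classical all_reals all_analysis.

Set Implicit Arguments.
Unset Strict Implicit.
Unset Printing Implicit Defensive.

Import Order.TTheory GRing.Theory Num.Theory.
Import numFieldNormedType.Exports.

Local Open Scope classical_set_scope.
Local Open Scope ring_scope.
Local Open Scope complex_scope.

(* C^(n+1) is handled as the real normed space of pairs (x, y), standing for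
   the vector x + iy.  The library norm on pairs is a sup norm; it is used only
   through its topology, and all lengths are measured with [g]. *)
Definition Cspace (R : realType) (n : nat) : normedModType R :=
  ('rV[R]_n.+1 * 'rV[R]_n.+1)%type.

(* C^oo: all iterated directional derivatives exist and are differentiable. *)
Definition smooth (R : realType) (U W : normedModType R) (f : U -> W) : Prop :=
  forall (vs : seq U) (x : U),
    differentiable (foldr (fun v (h : U -> W) => 'D_v h) f vs) x.

Definition smooth_curve (R : realType) (W : normedModType R) (c : R -> W) :
    Prop :=
  forall (k : nat) (t : R), derivable (derive1n k c : R^o -> W) t 1.

Section Sphere.
Variables (R : realType) (n : nat).
Local Notation V := (Cspace R n).
Implicit Types (z q u v w : V) (k t : R).

Definition coord z (j : 'I_n.+1) : R[i] := z.1 ord0 j +i* z.2 ord0 j.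

Definition hdot z w : R[i] := \sum_j coord z j * (coord w j)^*.

Definition g z w : R := complex.Re (hdot z w).

Definition muli z : V := (- z.2, z.1).

Definition sphere : set V := [set z | hdot z z = 1].

Definition tangent z : set V := [set v | g z v = 0].

Definition tangent_bundle : set (V * V) :=
  [set w | sphere w.1 /\ tangent w.1 w.2].

Definition form1 := V -> V -> R.
Definition form2 := V -> V -> V -> R.
Implicit Types (beta : form1) (sigma : form2).

(* Forms on the sphere are represented by forms on C^(n+1): every smooth form
   on the sphere, a closed submanifold, is the restriction of such a form, and
   restriction commutes with d.  Only the values at points of the sphere on
   tangent vectors are meaningful. *)
Definition smooth_form1 beta : Prop :=
  (forall z (a : R) u v, beta z (a *: u + v) = a * beta z u + beta z v) /\
  (forall v, smooth (fun z => beta z v : R^o)).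

(* dbeta(X, Y) = X beta(Y) - Y beta(X) - beta([X, Y]) on constant fields. *)
Definition ext_d beta : form2 := fun z u v =>
  'D_u (fun x => beta x v : R^o) z - 'D_v (fun x => beta x u : R^o) z.

Definition primitive sigma : set form1 :=
  [set beta | smooth_form1 beta /\
    forall z u v, sphere z -> tangent z u -> tangent z v ->
      ext_d beta z u v = sigma z u v].

Definition pointwise_norm beta z : \bar R :=
  ereal_sup [set `|beta z v|%:E | v in [set v | tangent z v /\ g v v <= 1]].

Definition sup_norm beta : \bar R :=
  ereal_sup [set pointwise_norm beta z | z in sphere].

(* For n >= 1 the sphere is simply connected, hence its own universal cover,
   so the primitives range over the forms on the sphere itself. *)
Definition mane_value sigma : \bar R :=
  ereal_inf [set ((2^-1)%:E * sup_norm beta ^+ 2)%E | beta in primitive sigma].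

Definition alpha : form1 := fun z v => 2^-1 * g (muli z) v.

Definition reeb z : V := (2 : R) *: muli z.

Definition lorentz sigma q u : V :=
  xget 0 [set w | tangent q w /\
                  forall v, tangent q v -> g w v = sigma q u v].

(* The metric is induced by the Euclidean one, so the Levi-Civita derivative of
   a tangent field W along a curve c is the tangential part of W'. *)
Definition tangent_proj z v : V := v - g v z *: z.

Definition cov_deriv (c W : R -> V) t : V := tangent_proj (c t) (derive1 W t).

Definition magnetic_geodesic sigma (c : R -> V) : Prop :=
  [/\ smooth_curve c,
      forall t, sphere (c t) &
      forall t, cov_deriv c (derive1 c) t = lorentz sigma (c t) (derive1 c t)].

Definition energy (c : R -> V) t : R := 2^-1 * g (derive1 c t) (derive1 c t).

Definition connects (c : R -> V) q0 q1 : Prop :=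
  exists s T : R, c (s - T / 2) = q0 /\ c (s + T / 2) = q1.

Definition connecting_geodesics k q0 q1 : set (R -> V) :=
  [set c | [/\ magnetic_geodesic (ext_d alpha) c,
               forall t, energy c t = k &
               connects c q0 q1]].

(* The preimage of A under the time-t map of the magnetic geodesic flow. *)
Definition flow_preimage sigma t (A : set (V * V)) : set (V * V) :=
  [set w | exists c : R -> V, [/\ magnetic_geodesic sigma c,
     (c 0, derive1 c 0) = w & A (c t, derive1 c t)]].

Definition borel_TV := g_sigma_algebraType (@open (V * V)%type).

(* Borel probabilities on the tangent bundle, a closed subset of V * V, are the
   Borel probabilities on V * V which it carries. *)
Definition invariant_probability sigma : set (probability borel_TV R) :=
  [set mu | mu tangent_bundle = 1%E /\
    forall t (A : set borel_TV), measurable A ->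
      mu (flow_preimage sigma t A) = mu A].

Definition lagrangian beta (w : V * V) : R := 2^-1 * g w.2 w.2 - beta w.1 w.2.

Definition action beta (mu : probability borel_TV R) : \bar R :=
  (\int[mu]_(w in tangent_bundle) (lagrangian beta w)%:E)%E.

Definition minimizing_measure beta : set (probability borel_TV R) :=
  [set mu | invariant_probability (ext_d beta) mu /\
    forall nu, invariant_probability (ext_d beta) nu ->
      (action beta mu <= action beta nu)%E].

Definition measure_support (mu : probability borel_TV R) : set (V * V) :=
  [set w | forall U : set (V * V), open U -> U w -> (0 < mu U)%E].

Definition mather_set beta : set (V * V) :=
  \bigcup_(mu in minimizing_measure beta) measure_support mu.

End Sphere.

Arguments alpha {R n}.
Arguments sphere {R n}.

Definition expi (R : realType) (x : R) : R[i] := cos x +i* sin x.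

(* Main.v *)
Require Import Defs.
From HB Require Import structures.
From mathcomp Require Import all_boot all_order all_algebra.
From mathcomp Require Import complex ring lra.
From mathcomp Require Import all_classical all_reals all_analysis.
From mathcomp Require Import measurable_realfun.

(** Write J for multiplication by i, and q for a point of the sphere.  The
    differential of alpha is d alpha (u, v) = g (Ju) v, so the magnetic geodesic
    equation reads c'' = Jc' - (E - h) c, where the squared speed
    E = g c' c' and the contact momentum h = g c' (Jc) are constant along c.
    This is a linear equation with constant coefficients, whose characteristic
    frequencies add up to 1: the magnetic geodesics are the curves
      c(t) = e^(i (1/2 + dl) t) A + e^(i (1/2 - dl) t) B,    dl >= 0,
    with A and B Hermitian orthogonal and |A|^2 + |B|^2 = 1
    ([twofreq_geodesic], [geodesic_twofreq]).  Put r = |A|^2 - |B|^2, which lies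
    in [-1, 1].  Two points of c at times differing by tau have the Hermitian
    product
      chord dl r tau = e^(i tau / 2) (cos (dl tau) + i r sin (dl tau)),
    and the energy k is given by 2 k = 1/4 + dl^2 + dl r.  Conversely two points
    whose product is such a chord with sin (dl tau) different from 0 are joined by
    a geodesic of that energy ([chord_connecting]), so the connection problem only
    involves the complex number p = <q0, q1>.

    By the energy relation, the squared modulus of a chord is
      |chord|^2 = 1 - 8 k + (r + 2 dl)^2 + (1 - r^2) cos^2 (dl tau).
    Hence |p|^2 >= 1 - 8 k is necessary.  Equality forces r = - 2 dl, so that dl
    is determined by k, and cos (dl tau) = 0, so that tau runs through an
    arithmetic progression: this yields the phases a_k + m b_k below the
    critical energy, and is impossible with p = 0 at the critical energy, where
    dl would be 0.  When |p|^2 > 1 - 8 k and 0 < |p| < 1, a whole interval of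
    values of dl is compatible with k and |p|; as dl runs through it and the
    points are joined after many oscillations of dl tau, the phase of the chord
    turns by more than a full circle, so that the phase of p is attained by the
    intermediate value theorem ([chord_phase]).  The extreme cases |p| = 1 and
    p = 0 are settled by explicit geodesics.

    The norm of alpha is 1/2 everywhere, which bounds the critical value above
    by 1/8.  For the lower bound, let beta be a primitive of d alpha.  By Stokes
    on a hemisphere bounded by a closed Reeb orbit ([circle_integral]), beta and
    alpha have the same integral over that orbit; it equals pi, the orbit has
    length 2 pi, hence |beta| is at least 1/2 at some point.  The hemisphere
    uses a direction Hermitian orthogonal to the orbit, which exists when
    n >= 1.

    For the Mather set, completing the square gives
      L (q, v) = 1/2 |v - Jq / 2|^2 - 1/8
    on the tangent bundle.  So every action is at least - 1/8, and a measure
    attaining - 1/8 is supported by the closed set of the (q, Jq / 2), which are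
    the (q, R_q / 4).  Each such point lies in the support of a minimizing
    measure, namely the uniform measure on the lift of the Reeb orbit through
    q, which is a magnetic geodesic ([reeb_measure_minimizing]). *)

Set Implicit Arguments.
Unset Strict Implicit.
Unset Printing Implicit Defensive.

Import Order.TTheory GRing.Theory Num.Theory.
Import numFieldNormedType.Exports.
Local Open Scope classical_set_scope.
Local Open Scope ring_scope.
Local Open Scope complex_scope.

(** * Hermitian algebra *)

Section Algebra.
Variables (R : realType) (n : nat).
Local Notation V := (Cspace R n).
Implicit Types (z w u v q : V) (a b : R).

Lemma gE z w : g z w = \sum_j (z.1 ord0 j * w.1 ord0 j + z.2 ord0 j * w.2 ord0 j).
Proof.
rewrite /g /hdot raddf_sum /=; apply: eq_bigr => j _.
by rewrite /coord /=; ring.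
Qed.

(** The imaginary part of the Hermitian product is [g z (muli w)], so Hermitian
    computations reduce to bilinear ones for the metric. *)
Lemma hdotE z w : hdot z w = g z w +i* g z (muli w).
Proof.
apply/eqP; rewrite eq_complex /= eqxx /=; apply/eqP.
rewrite gE /hdot raddf_sum /=; apply: eq_bigr => j _.
by rewrite /coord /= !mxE; ring.
Qed.

Lemma gC z w : g z w = g w z.
Proof. by rewrite !gE; apply: eq_bigr => j _; ring. Qed.

Lemma gDl u v w : g (u + v) w = g u w + g v w.
Proof. by rewrite !gE -big_split; apply: eq_bigr => j _ /=; rewrite !mxE; ring. Qed.

Lemma gZl a u w : g (a *: u) w = a * g u w.
Proof. by rewrite !gE mulr_sumr; apply: eq_bigr => j _ /=; rewrite !mxE; ring. Qed.

Lemma gNl u w : g (- u) w = - g u w.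
Proof. by rewrite -scaleN1r gZl mulN1r. Qed.

Lemma gDr u v w : g w (u + v) = g w u + g w v.
Proof. by rewrite gC gDl !(gC w). Qed.

Lemma gZr a u w : g w (a *: u) = a * g w u.
Proof. by rewrite gC gZl gC. Qed.

Lemma gNr u w : g w (- u) = - g w u.
Proof. by rewrite gC gNl gC. Qed.

Lemma g0l w : g 0 w = 0.
Proof. by rewrite -(scale0r 0) gZl mul0r. Qed.

Lemma g0r w : g w 0 = 0.
Proof. by rewrite gC g0l. Qed.

Lemma muliK z : muli (muli z) = - z.
Proof. by []. Qed.

Lemma muliD u v : muli (u + v) = muli u + muli v.
Proof. by rewrite /muli /= opprD. Qed.

Lemma muliZ a u : muli (a *: u) = a *: muli u.
Proof. by rewrite /muli /= -scalerN. Qed.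

Lemma muliN u : muli (- u) = - muli u.
Proof. by []. Qed.

Lemma g_muli_l z w : g (muli z) w = - g z (muli w).
Proof.
by rewrite !gE -sumrN; apply: eq_bigr => j _ /=; rewrite !mxE; ring.
Qed.

Lemma g_muli2 z w : g (muli z) (muli w) = g z w.
Proof. by rewrite g_muli_l muliK gNr opprK. Qed.

Lemma g_muli_r z : g z (muli z) = 0.
Proof. by have := g_muli_l z z; rewrite gC; lra. Qed.

Lemma g_ge0 z : 0 <= g z z.
Proof.
by rewrite gE; apply: sumr_ge0 => j _; rewrite -!expr2 addr_ge0 ?sqr_ge0.
Qed.

Lemma g_eq0 z : g z z = 0 -> z = 0.
Proof.
rewrite gE => /eqP; rewrite psumr_eq0; last first.
  by move=> j _; rewrite -!expr2 addr_ge0 ?sqr_ge0.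
move=> /allP h.
have {}h j : z.1 ord0 j = 0 /\ z.2 ord0 j = 0.
  have := h j (mem_index_enum j).
  rewrite -!expr2 paddr_eq0 ?sqr_ge0// !sqrf_eq0.
  by move=> /andP[/eqP-> /eqP->].
case: z h => x y /= h; congr pair; apply/rowP => j; rewrite mxE.
  by case: (h j).
by case: (h j).
Qed.

Lemma g_sqrD u v : g (u + v) (u + v) = g u u + 2 * g u v + g v v.
Proof. by rewrite gDl !gDr (gC v u); ring. Qed.

Definition g_linE := (gDl, gDr, gNl, gNr, gZl, gZr, muliD, muliN, muliZ, muliK, g_muli2, g_muli_r).

Lemma g_CauchySchwarz u v : g u v ^+ 2 <= g u u * g v v.
Proof.
have [/g_eq0 ->|v0] := eqVneq (g v v) 0; first by rewrite !g0r mulr0 expr0n.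
have vp : 0 < g v v by rewrite lt_neqAle eq_sym v0 g_ge0.
have := g_ge0 (g v v *: u - g u v *: v).
rewrite !g_linE (gC v u).
have -> : g v v * (g v v * g u u + - (g u v * g u v)) +
 - (g u v * (g v v * g u v + - (g u v * g v v))) =
  g v v * (g u u * g v v - g u v ^+ 2) by ring.
by rewrite pmulr_rge0// subr_ge0.
Qed.

Lemma sphereE z : sphere z <-> g z z = 1.
Proof.
rewrite /sphere /= hdotE g_muli_r; split=> [|->] //.
by case.
Qed.

Lemma tangent_muli q : tangent q (muli q).
Proof. exact: g_muli_r. Qed.

Lemma tangent_projP q v : sphere q -> tangent q (tangent_proj q v).
Proof.
move=> /sphereE q1; rewrite /tangent /tangent_proj /= !g_linE q1 (gC q v); ring.
Qed.

End Algebra.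

(** * Differential calculus on the ambient space *)

Section Calculus.
Variables (R : realType).

(** A continuous linear map commutes with difference quotients. *)
Lemma is_derive_linear (U W : normedModType R) (f : U -> W) (c : R -> U) (t : R) (dc : U) :
  (forall a u v, f (a *: u + v) = a *: f u + f v) -> continuous f ->
  is_derive t (1 : R) c dc -> is_derive t (1 : R) (f \o c) (f dc).
Proof.
move=> fL fc dcP.
have f0 : f 0 = 0 by have := fL (-1) 0 0; rewrite scaler0 addr0 scaleN1r addNr.
have fZ a u : f (a *: u) = a *: f u.
  by have := fL a u 0; rewrite !addr0 f0 addr0.
have fB u v : f (u - v) = f u - f v.
  by rewrite [u - v]addrC -scaleN1r fL scaleN1r addrC.
have H : (fun h => h^-1 *: ((f \o c) (h *: (1 : R^o) + t) - (f \o c) t)) @ 0^' --> f dc.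
  have -> : (fun h => h^-1 *: ((f \o c) (h *: (1 : R^o) + t) - (f \o c) t)) =
      f \o (fun h => h^-1 *: (c (h *: (1 : R^o) + t) - c t)).
    by apply/funext => h /=; rewrite fZ fB.
  apply: cvg_comp; last exact: fc.
  by have /cvg_ex [l] := @ex_derive _ _ _ _ _ _ _ dcP;
    rewrite -(@derive_val _ _ _ _ _ _ _ dcP) => /[dup] /cvg_lim <-.
split; first by apply/cvg_ex; exists (f dc).
exact/cvg_lim.
Qed.

Lemma is_derive_scalel (W : normedModType R) (f : R -> R) (w : W) (t df : R) :
  is_derive t 1 f df -> is_derive t 1 (fun x => f x *: w) (df *: w).
Proof.
move=> fd; apply: (@is_derive_linear R^o W (fun a => a *: w)) fd.
  by move=> a u v; rewrite scalerDl -scalerA.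
by move=> x; apply: scalel_continuous.
Qed.

Variable n : nat.
Local Notation V := (Cspace R n).

Lemma coord1_continuous j : continuous (fun z : V => z.1 ord0 j : R).
Proof.
move=> z; apply: (@continuous_comp _ _ _ (fst : V -> 'rV[R]_n.+1) (fun M :
  'rV[R]_n.+1 => M ord0 j)).
  exact: cvg_fst.
exact: coord_continuous.
Qed.

Lemma coord2_continuous j : continuous (fun z : V => z.2 ord0 j : R).
Proof.
move=> z; apply: (@continuous_comp _ _ _ (snd : V -> 'rV[R]_n.+1) (fun M :
  'rV[R]_n.+1 => M ord0 j)).
  exact: cvg_snd.
exact: coord_continuous.
Qed.

Lemma muli_continuous : continuous (@muli R n).
Proof.
move=> z; apply: (@cvg_pair _ _ _ _ (nbhs (- z.2)) (nbhs z.1)) => //=.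
  by apply: cvgN; exact: cvg_snd.
exact: cvg_fst.
Qed.

Lemma g_continuous (T : topologicalType) (u v : T -> V) x :
  {for x, continuous u} -> {for x, continuous v} ->
  {for x, continuous (fun y => g (u y) (v y) : R)}.
Proof.
move=> uc vc.
have c1 (f : T -> V) j (fc : {for x, continuous f}) : {for x, continuous (fun y => (f y).1 ord0 j)}.
  exact: (continuous_comp fc (@coord1_continuous j (f x))).
have c2 (f : T -> V) j (fc : {for x, continuous f}) : {for x, continuous (fun y => (f y).2 ord0 j)}.
  exact: (continuous_comp fc (@coord2_continuous j (f x))).
rewrite /prop_for /continuous_at gE; under eq_cvg do rewrite gE.
apply: cvg_big => [|j _]; first exact: add_continuous.
by apply: cvgD; apply: cvgM; [exact: c1|exact: c1|exact: c2|exact: c2].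
Qed.

Lemma is_derive_muli (c : R -> V) (t : R) (dc : V) :
  is_derive t 1 c dc -> is_derive t 1 (fun x => muli (c x)) (muli dc).
Proof.
apply: (@is_derive_linear _ _ (@muli R n)).
  by move=> a u v; rewrite muliD muliZ.
exact: muli_continuous.
Qed.

Lemma is_derive_g (c d : R -> V) (t : R) (dc dd : V) :
  is_derive t 1 c dc -> is_derive t 1 d dd ->
  is_derive t 1 (fun x => g (c x) (d x) : R^o) (g dc (d t) + g (c t) dd).
Proof.
move=> cP dP.
have -> : (fun y => g (c y) (d y) : R^o) = (\sum_(j < n.+1) (fun y =>
   ((c y).1 ord0 j * (d y).1 ord0 j + (c y).2 ord0 j * (d y).2 ord0 j))).
  by apply/funext => y; rewrite gE fct_sumE.
have d1 (f : R -> V) j (df : V) : is_derive t 1 f df -> is_derive t 1 (fun y =>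
  (f y).1 ord0 j : R) (df.1 ord0 j : R).
  apply: (@is_derive_linear _ R^o (fun z : V => z.1 ord0 j : R^o)).
    by move=> a u v; rewrite !mxE.
  exact: coord1_continuous.
have d2 (f : R -> V) j (df : V) : is_derive t 1 f df -> is_derive t 1 (fun y =>
  (f y).2 ord0 j : R) (df.2 ord0 j : R).
  apply: (@is_derive_linear _ R^o (fun z : V => z.2 ord0 j : R^o)).
    by move=> a u v; rewrite !mxE.
  exact: coord2_continuous.
apply: is_derive_eq.
rewrite !gE -big_split; apply: eq_bigr => j _ /=; rewrite /GRing.scale /=; ring.
Qed.

End Calculus.

(** * Rotation by a unit complex number and two-frequency curves *)

Section Rotation.
Variables (R : realType) (n : nat).
Local Notation V := (Cspace R n).
Implicit Types (z w u v q : V) (a b x y t : R).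

(** Locked, because [cos x *: v + sin x *: muli v] is otherwise taken for an
    ordinary sum when rewriting with the linearity lemmas. *)
Definition crot x v : V := locked (cos x *: v + sin x *: muli v).

Lemma crotE x v : crot x v = cos x *: v + sin x *: muli v.
Proof. by rewrite /crot -lock. Qed.

Lemma crot0 v : crot 0 v = v.
Proof. by rewrite !crotE cos0 sin0 scale1r scale0r addr0. Qed.

Lemma crotL x a u v : crot x (a *: u + v) = a *: crot x u + crot x v.
Proof.
rewrite !crotE muliD muliZ !scalerDr !scalerA !(mulrC a) addrACA //.
Qed.

Lemma crotD x u v : crot x (u + v) = crot x u + crot x v.
Proof. by have := crotL x 1 u v; rewrite !scale1r. Qed.

Lemma crot_zero x : crot x 0 = 0.
Proof. by apply: (addrI (crot x 0)); rewrite -crotD !addr0. Qed.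

Lemma crotZ x a u : crot x (a *: u) = a *: crot x u.
Proof. by have := crotL x a u 0; rewrite crot_zero !addr0. Qed.

Lemma crot_muli x u : crot x (muli u) = muli (crot x u).
Proof. by rewrite !crotE muliD !muliZ. Qed.

Lemma crotK x y v : crot x (crot y v) = crot (x + y) v.
Proof.
rewrite !crotE muliD !muliZ muliK sinD cosD !scalerDr !scalerA scalerN !scalerDl.
rewrite scaleNr -!addrA; congr (_ + _).
rewrite [RHS]addrCA [in RHS]addrC -!addrA addrCA; congr (_ + _).
by rewrite addrC.
Qed.

Lemma g_crot x u v : g (crot x u) (crot x v) = g u v.
Proof.
rewrite !crotE !g_linE g_muli_l.
have -> : cos x * (cos x * g u v + sin x * g u (muli v)) +
  sin x * (cos x * - g u (muli v) + sin x * g u v) =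
  (cos x ^+ 2 + sin x ^+ 2) * g u v by ring.
by rewrite cos2Dsin2 mul1r.
Qed.

Lemma expiD x y : expi (x + y) = expi x * expi y.
Proof.
rewrite /expi sinD cosD; apply/eqP; rewrite eq_complex /=.
by apply/andP; split; apply/eqP; ring.
Qed.

Lemma hdot_crot_l x u v : hdot (crot x u) v = expi x * hdot u v.
Proof.
rewrite !hdotE !crotE !g_linE g_muli_l; apply/eqP; rewrite eq_complex /=.
by apply/andP; split; apply/eqP; ring.
Qed.

Lemma hdot_crot x u v : hdot (crot x u) (crot x v) = hdot u v.
Proof. by rewrite !hdotE -crot_muli !g_crot. Qed.

Lemma is_derive_crot (a t : R) v :
  is_derive t (1 : R) (fun t => crot (a * t) v) (a *: crot (a * t) (muli v)).
Proof.
have da : is_derive t (1 : R) (fun t => a * t) a.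
  by apply: is_derive_eq; rewrite /GRing.scale /= mulr1.
have dc : is_derive t (1 : R) (fun t => cos (a * t)) (- (a * sin (a * t))).
  by apply: is_derive_eq; rewrite /GRing.scale /=; ring.
have ds : is_derive t (1 : R) (fun t => sin (a * t)) (a * cos (a * t)).
  by apply: is_derive_eq; rewrite /GRing.scale /=; ring.
have -> : (fun t => crot (a * t) v) = (fun t => cos (a * t) *: v + sin (a * t) *: muli v).
  by apply/funext => x; rewrite crotE.
apply: is_derive_eq (is_deriveD (is_derive_scalel v dc) (is_derive_scalel (muli v) ds)) _.
by rewrite !crotE muliK scalerDr !scalerA scalerN scaleNr addrC.
Qed.

Definition twofreq (a b : R) (A B : V) t : V := crot (a * t) A + crot (b * t) B.

Lemma is_derive_twofreq a b A B t : is_derive t (1 : R)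
  (twofreq a b A B) (twofreq a b (a *: muli A) (b *: muli B) t).
Proof.
rewrite /twofreq !crotZ; apply: is_deriveD; exact: is_derive_crot.
Qed.

Lemma derive1_twofreq a b A B :
  derive1 (twofreq a b A B) = twofreq a b (a *: muli A) (b *: muli B).
Proof.
apply/funext => t; rewrite derive1E; apply: derive_val.
exact: is_derive_twofreq.
Qed.

(** Two-frequency curves are stable under differentiation, which multiplies the
    amplitudes by [i a] and [i b]. *)
Lemma twofreq_smooth a b A B : smooth_curve (twofreq a b A B).
Proof.
move=> k t.
suff [A' [B' ->]] : exists A' B', derive1n k (twofreq a b A B) = twofreq a b A' B'.
  exact: (@ex_derive _ _ _ _ _ _ _ (is_derive_twofreq a b A' B' t)).
elim: k => [|k [A' [B' IH]]]; first by exists A, B.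
by rewrite derive1nS IH derive1_twofreq; do 2 eexists.
Qed.

End Rotation.

(** * The magnetic geodesic equation *)

Section Geodesic.
Variables (R : realType) (n : nat).
Local Notation V := (Cspace R n).
Implicit Types (z w u v q : V) (a b x y : R).

Lemma derive_linear (f : V -> R^o) (u z : V) :
  (forall a u v, f (a *: u + v) = a *: f u + f v) -> 'D_u f z = f u.
Proof.
move=> fL.
have f0 : f 0 = 0 by have := fL (-1) 0 0; rewrite scaler0 addr0 scaleN1r addNr.
apply: lim_near_cst => //; near=> h.
rewrite /= fL addrK scalerA mulVf ?scale1r//.
by near: h; exact: nbhs_dnbhs_neq.
Unshelve. all: by end_near. Qed.

Lemma ext_d_alphaE z u v : ext_d alpha z u v = g (muli u) v.
Proof.
rewrite /ext_d /alpha !derive_linear; first last.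
- by move=> a u' v'; rewrite muliD muliZ gDl gZl /GRing.scale /=; ring.
- by move=> a u' v'; rewrite muliD muliZ gDl gZl /GRing.scale /=; ring.
by rewrite (g_muli_l v) (gC v); field.
Qed.

(** The Riesz representative of [g (muli u) _] on the tangent space is the
    tangential part of [muli u]; uniqueness makes [xget] return it. *)
Lemma lorentzE q u : sphere q ->
  lorentz (ext_d alpha) q u = tangent_proj q (muli u).
Proof.
move=> qS; have q1 := (sphereE q).1 qS.
have gproj w v : tangent q v -> g (tangent_proj q w) v = g w v.
  by rewrite /tangent /tangent_proj /= => qv; rewrite !g_linE qv mulr0 subr0.
apply: xget_unique.
  split; first exact: tangent_projP.
  by move=> v qv; rewrite ext_d_alphaE gproj.
move=> w [qw wE]; apply/eqP; rewrite -subr_eq0; apply/eqP/g_eq0.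
set d := w - _.
have qd : tangent q d.
  by have := tangent_projP (muli u) qS; rewrite /d /tangent /= gDr gNr qw => ->; rewrite subrr.
by rewrite {1}/d gDl gNl gproj// (wE d qd) ext_d_alphaE subrr.
Qed.

(** Differentiating twice multiplies the amplitudes by [- a^2] and [- b^2], and
    [a] and [b] are the roots of [x^2 = x - a b] when their sum is 1. *)
Lemma twofreq_ode a b (A B : V) (t : R) : a + b = 1 ->
  twofreq a b (a *: muli (a *: muli A)) (b *: muli (b *: muli B)) t =
  muli (twofreq a b (a *: muli A) (b *: muli B) t) + (a * b) *: twofreq a b A B t.
Proof.
move=> ab1.
have key x y (C : V) : x + y = 1 ->
    x *: muli (x *: muli C) = muli (x *: muli C) + (x * y) *: C.
  move=> xy1; have -> : y = 1 - x by rewrite -xy1 addrAC subrr add0r.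
  by rewrite muliZ muliK !scalerN scalerA mulrBr mulr1 scalerBl addrA addNr add0r.
rewrite (key a b)// (key b a) 1?[b + a]addrC// (mulrC b) /twofreq.
by rewrite scalerDr muliD -!crot_muli -!crotZ addrACA -!crotD.
Qed.

(** By [twofreq_ode] the acceleration differs from [i] times the velocity by a
    multiple of the position, which the tangential projection kills.  Hermitian
    orthogonality of the amplitudes keeps the norms constant. *)
Lemma twofreq_geodesic a b (A B : V) : a + b = 1 ->
  g A A + g B B = 1 -> g A B = 0 -> g A (muli B) = 0 ->
  magnetic_geodesic (ext_d alpha) (twofreq a b A B) /\
  forall t, energy (twofreq a b A B) t =
    2^-1 * (a ^+ 2 * g A A + b ^+ 2 * g B B).
Proof.
move=> ab1 AB1 AB AJB.
have norm2 (a' b' : R) (C D : V) t : g C D = 0 -> g C (muli D) = 0 ->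
    g (twofreq a' b' C D t) (twofreq a' b' C D t) = g C C + g D D.
  move=> CD CJD; rewrite /twofreq g_sqrD !g_crot.
  have CDr x y : g (crot x C) (crot y D) = 0.
    by rewrite !crotE !g_linE g_muli_l CD CJD; ring.
  by rewrite CDr mulr0 addr0.
have S t : sphere (twofreq a b A B t) by apply/sphereE; rewrite norm2.
split; last first.
  move=> t; rewrite /energy derive1_twofreq norm2.
  - by rewrite !g_linE; ring.
  - by rewrite !g_linE AB; ring.
  - by rewrite muliZ gZl gZr g_muli2 AJB !mulr0.
split=> //; first exact: twofreq_smooth.
move=> t; rewrite lorentzE// /cov_deriv !derive1_twofreq.
set c := twofreq a b A B t.
rewrite twofreq_ode// -/c.
rewrite /tangent_proj gDl gZl (sphereE _).1; last exact: S.
by rewrite mulr1 scalerDl opprD addrACA subrr addr0.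
Qed.

(** Differentiating the constraint [|c|^2 = 1] twice expresses the Lagrange
    multiplier [m] through the speed and the contact momentum, both of which are
    first integrals. *)
Lemma constraint_ode (c c' c'' : R -> V) (m : R -> R) :
  (forall t : R, is_derive t (1 : R) c (c' t)) ->
  (forall t : R, is_derive t (1 : R) c' (c'' t)) ->
  (forall t, g (c t) (c t) = 1) ->
  (forall t, c'' t = muli (c' t) + m t *: c t) ->
  exists E h : R, forall t : R,
  [/\ g (c' t) (c' t) = E, g (c' t) (muli (c t)) = h,
      g (c' t) (c t) = 0 & m t = - (E - h)].
Proof.
move=> d1 d2 cc eqn.
have c'c t : g (c' t) (c t) = 0.
  have H := is_derive_g (d1 t) (d1 t).
  have := @derive_val _ _ _ _ _ _ _ H.
  have -> : (fun x => g (c x) (c x) : R^o) = cst 1 by apply/funext.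
  rewrite derive_cst (gC (c t)) => h; lra.
have const (f : R -> R) : (forall t : R, is_derive t (1 : R) f 0) -> forall t, f t = f 0.
  by move=> fd t; exact: is_derive_0_is_cst.
have E t : g (c' t) (c' t) = g (c' 0) (c' 0).
  apply: (const (fun t => g (c' t) (c' t))) => {}t.
  apply: is_derive_eq (is_derive_g (d2 t) (d2 t)) _.
  by rewrite eqn !g_linE (gC (c t)) c'c g_muli_l g_muli_r; ring.
have h t : g (c' t) (muli (c t)) = g (c' 0) (muli (c 0)).
  apply: (const (fun t => g (c' t) (muli (c t)))) => {}t.
  apply: is_derive_eq (is_derive_g (d2 t) (is_derive_muli (d1 t))) _.
  by rewrite eqn !g_linE c'c; ring.
have k t : g (c'' t) (c t) = - g (c' 0) (c' 0).
  have H := is_derive_g (d2 t) (d1 t).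
  have := @derive_val _ _ _ _ _ _ _ H.
  have -> : (fun x => g (c' x) (c x) : R^o) = cst 0 by apply/funext.
  by rewrite derive_cst E => hh; lra.
exists (g (c' 0) (c' 0)), (g (c' 0) (muli (c 0))) => t; split=> //.
by have := k t; rewrite eqn gDl gZl cc g_muli_l h; lra.
Qed.

(** The geodesic equation prescribes [c''] only up to a multiple of [c], which
    [constraint_ode] determines; what results is a linear equation with constant
    coefficients. *)
Lemma geodesic_ode (c : R -> V) : magnetic_geodesic (ext_d alpha) c ->
  exists E h : R, forall t : R,
  [/\ g (derive1 c t) (derive1 c t) = E /\ g (derive1 c t) (muli (c t)) = h,
      g (derive1 c t) (c t) = 0,
      is_derive t (1 : R) c (derive1 c t) &
      is_derive t (1 : R) (derive1 c)
        (muli (derive1 c t) - (E - h) *: c t)].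
Proof.
move=> [smc cS geo].
have d1 t : is_derive t (1 : R) c (derive1 c t).
  by rewrite derive1E; apply/derivableP; exact: (smc 0%N t).
have d2 t : is_derive t (1 : R) (derive1 c) (derive1 (derive1 c) t).
  by rewrite [derive1 (derive1 c) t]derive1E; apply/derivableP; exact: (smc 1%N t).
have cc t : g (c t) (c t) = 1 by apply/sphereE.
have eqn t : derive1 (derive1 c) t = muli (derive1 c t) +
   (g (derive1 (derive1 c) t) (c t) - g (muli (derive1 c t)) (c t)) *: c t.
  have := geo t; rewrite lorentzE// /cov_deriv /tangent_proj.
  move: (derive1 (derive1 c) t) => c2 /eqP.
  by rewrite subr_eq => /eqP H; rewrite {1}H scalerBl addrAC addrA.
have [E [h Eh]] := constraint_ode d1 d2 cc eqn.
exists E, h => t; have [h1 h2 h3 h4] := Eh t; split => //.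
by apply: is_derive_eq (d2 t) _; rewrite {1}eqn h4 scaleNr.
Qed.

End Geodesic.

(** * Every magnetic geodesic is a two-frequency curve *)

Section Connection.
Variables (R : realType) (n : nat).
Local Notation V := (Cspace R n).
Implicit Types (z w u v q P : V) (a b x y : R).

(** The quantity [|d' - i d / 2|^2 + (k + 1/4) |d|^2] is conserved.  Both terms
    are nonnegative, hence vanish; so [d' = i d / 2], and [|d|] is constant.  This
    avoids the general uniqueness theorem for differential equations and covers
    the degenerate value [k = - 1/4]. *)
Lemma magnetic_ode_unique (d d' : R -> V) (k : R) : - 4^-1 <= k ->
  (forall t : R, is_derive t (1 : R) d (d' t)) ->
  (forall t : R, is_derive t (1 : R) d' (muli (d' t) - k *: d t)) ->
  d 0 = 0 -> d' 0 = 0 -> forall t, d t = 0.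
Proof.
move=> kge d1 d2 d0 d'0.
have const (f df : R -> R) : (forall t : R, is_derive t (1 : R) f (df t)) ->
    (forall t, df t = 0) -> forall t, f t = f 0.
  by move=> fd df0 t; apply: is_derive_0_is_cst => s; rewrite -(df0 s).
have N0 t : g (d' t) (d' t) - g (d' t) (muli (d t)) + (k + 2^-1) * g (d t) (d t) = 0.
  have e1 s := is_derive_g (d2 s) (d2 s).
  have e2 s := is_derive_g (d2 s) (is_derive_muli (d1 s)).
  have e3 s := is_derive_g (d1 s) (d1 s).
  have e s := is_deriveD (is_deriveB (e1 s) (e2 s)) (is_deriveZ (k + 2^-1) (e3 s)).
  etransitivity; first apply: (const _ _ e) => s; last first.
    change (g (d' 0) (d' 0) - g (d' 0) (muli (d 0)) + (k + 2^-1) * g (d 0) (d 0) = 0).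
    by rewrite d0 d'0 !g0l subrr mulr0 addr0.
  rewrite !g_linE (gC (muli (d' s)) (d' s)) g_muli_r (gC (d s) (d' s)) /GRing.scale /=.
  by field.
have p0 t : d' t = 2^-1 *: muli (d t).
  apply/eqP; rewrite -subr_eq0; apply/eqP; apply: g_eq0.
  have := N0 t; rewrite !g_linE (gC (muli (d t))).
  have h1 := g_ge0 (d' t - 2^-1 *: muli (d t)).
  rewrite !g_linE (gC (muli (d t))) in h1.
  have h2 : 0 <= (k + 4^-1) * g (d t) (d t).
    by apply: mulr_ge0; [lra|exact: g_ge0].
  move=> h3; lra.
have D0 t : g (d t) (d t) = 0.
  have := const _ _ (fun s => is_derive_g (d1 s) (d1 s)) _ t; rewrite d0 g0l; apply => s.
  by rewrite p0 !g_linE (gC (muli _)) g_muli_r; ring.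
by move=> t; apply: g_eq0.
Qed.

(** [halfA] and [halfB] solve [A + B = q], [i A - i B = P]: they are the
    amplitudes of the geodesic with frequencies [1/2 + dl] and [1/2 - dl] that
    leaves [q] with velocity [i q / 2 + dl P]. *)
Definition halfA q P : V := 2^-1 *: (q - muli P).
Definition halfB q P : V := 2^-1 *: (q + muli P).

Lemma half_gram q P r : g q q = 1 -> g P P = 1 -> g P q = 0 -> g P (muli q) = r ->
  [/\ g (halfA q P) (halfA q P) = (1 + r) / 2,
      g (halfB q P) (halfB q P) = (1 - r) / 2,
      g (halfA q P) (halfB q P) = 0 &
      g (halfA q P) (muli (halfB q P)) = 0].
Proof.
move=> q1 P1 Pq <-; have qP : g q P = 0 by rewrite gC.
have e : g q (muli P) = - g P (muli q) by rewrite gC g_muli_l.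
have e' : g (muli P) q = - g P (muli q) by rewrite g_muli_l.
rewrite /halfA /halfB; split; rewrite !g_linE ?e ?e' ?q1 ?P1 ?qP ?Pq; by field.
Qed.

Lemma scale_half u : 2^-1 *: (u + u) = u.
Proof. by rewrite scalerDr -scalerDl -div1r -splitr scale1r. Qed.

Lemma halfAB q P : halfA q P + halfB q P = q.
Proof. by rewrite /halfA /halfB -scalerDr addrACA addNr addr0 scale_half. Qed.

Lemma halfAB_muli q P : muli (halfA q P) - muli (halfB q P) = P.
Proof.
rewrite /halfA /halfB !muliZ -scalerBr !muliD !muliN !muliK opprK opprD opprK.
by rewrite addrACA subrr add0r scale_half.
Qed.

(** The coefficient [E - h] of the linear equation depends on the initial data
    only, so the difference of the two curves solves that equation.  The bound
    [E - h >= - 1/4] required by [magnetic_ode_unique] comes from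
    [|c' - i c / 2|^2 = 1/4 + E - h]. *)
Lemma geodesic_unique (c1 c2 : R -> V) :
  magnetic_geodesic (ext_d alpha) c1 -> magnetic_geodesic (ext_d alpha) c2 ->
  c1 0 = c2 0 -> derive1 c1 0 = derive1 c2 0 -> c1 = c2.
Proof.
move=> geo1 geo2 e0 e1.
have cc : g (c1 0) (c1 0) = 1 by case: geo1 => _ /(_ 0) /sphereE.
have [E1 [h1 O1]] := geodesic_ode geo1; have [E2 [h2 O2]] := geodesic_ode geo2.
move: e1 O1 O2 {geo1 geo2}; move: (derive1 c1) (derive1 c2) => v1 v2 e1 O1 O2.
have [[E1E h1E] _ _ _] := O1 0; have [[E2E h2E] _ _ _] := O2 0.
have EE : E2 = E1 by rewrite -E2E -E1E e1.
have hh : h2 = h1 by rewrite -h2E -h1E e0 e1.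
have k_ge : - 4^-1 <= E1 - h1.
  have := g_ge0 (v1 0 - 2^-1 *: muli (c1 0)).
  by rewrite !g_linE (gC (muli (c1 0))) E1E h1E cc; lra.
apply/funext => t; apply/eqP; rewrite -subr_eq0; apply/eqP.
apply: (@magnetic_ode_unique (fun s => c1 s - c2 s) (fun s => v1 s - v2 s) (E1 - h1)) => //.
- move=> s; have [_ _ d1 _] := O1 s; have [_ _ d2 _] := O2 s.
  exact: is_deriveB.
- move=> s; have [_ _ _ d1] := O1 s; have [_ _ _ d2] := O2 s.
  have vec (X Y u v : V) k : muli X - k *: u - (muli Y - k *: v) =
      muli (X - Y) - k *: (u - v).
    by rewrite muliD muliN scalerBr !opprD !opprK addrACA.
  rewrite EE hh in d2.
  by apply: is_derive_eq (is_deriveB d1 d2) _; exact: vec.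
- by rewrite e0 subrr.
- by rewrite e1 subrr.
Qed.

(** The initial velocity is [i c(0) / 2 + p] with [p] orthogonal to [c(0)].
    Taking [dl = |p|], the two-frequency curve with amplitudes [halfA] and
    [halfB] has the same initial data when [p] is not 0; otherwise the geodesic is
    a Reeb orbit. *)
Lemma geodesic_twofreq (c : R -> V) : magnetic_geodesic (ext_d alpha) c ->
  exists (dl r : R) (A B : V),
  [/\ 0 <= dl, g A A = (1 + r) / 2, g B B = (1 - r) / 2, g A B = 0 /\ g A (muli B) = 0 &
      c = twofreq (2^-1 + dl) (2^-1 - dl) A B].
Proof.
move=> geo; have [E [h Eh]] := geodesic_ode geo.
have cc : g (c 0) (c 0) = 1 by case: geo => _ /(_ 0) /sphereE.
have uniq a b A B : a + b = 1 -> g A A + g B B = 1 -> g A B = 0 -> g A (muli B) = 0 ->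
    A + B = c 0 -> a *: muli A + b *: muli B = derive1 c 0 -> c = twofreq a b A B.
  move=> ab1 AB1 AB AJB AB0 ABv; have [geoAB _] := twofreq_geodesic ab1 AB1 AB AJB.
  apply: (geodesic_unique geo geoAB); first by rewrite /twofreq !mulr0 !crot0 AB0.
  by rewrite derive1_twofreq /twofreq !mulr0 !crot0 ABv.
have [[gE gh] gc' _ _] := Eh 0.
move: (derive1 c 0) uniq gE gh gc' => v uniq gE gh gc' {Eh}.
pose p := v - 2^-1 *: muli (c 0).
have gpp : g p p = 4^-1 + (E - h).
  by rewrite /p !g_linE (gC (muli _) v) gE gh cc; field.
have gpc : g p (c 0) = 0.
  by rewrite /p !g_linE gc' (gC (muli _)) g_muli_r; ring.
have k_ge : 0 <= 4^-1 + (E - h) by rewrite -gpp g_ge0.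
pose dl := Num.sqrt (4^-1 + (E - h)).
have dl2 : dl ^+ 2 = 4^-1 + (E - h) by rewrite sqr_sqrtr.
have dl0 : 0 <= dl by exact: sqrtr_ge0.
have ab1 : 2^-1 + dl + (2^-1 - dl) = 1 by field.
have [dl_eq0|dl_neq0] := eqVneq dl 0.
  have p0 : p = 0 by apply: g_eq0; rewrite gpp -dl2 dl_eq0 expr0n.
  (* Without normal component the geodesic is a Reeb orbit, and any unit normal
  vector could be used; the amplitude B is taken to be 0. *)
  have J0 : muli (0 : V) = 0 by rewrite /muli /= oppr0.
  exists dl, 1, (c 0), 0; split => //.
  - by rewrite cc; field.
  - by rewrite g0l subrr mul0r.
  - by rewrite J0 !g0r.
  - apply: uniq => //; rewrite ?J0 ?g0r ?addr0// scaler0 addr0 dl_eq0 addr0.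
    by apply/eqP; rewrite eq_sym -subr_eq0; apply/eqP.
pose P := dl^-1 *: p.
have PP : g P P = 1 by rewrite /P gZl gZr gpp -dl2; field.
have Pc : g P (c 0) = 0 by rewrite /P gZl gpc mulr0.
have [h1 h2 h3 h4] := half_gram cc PP Pc erefl.
exists dl, (g P (muli (c 0))), (halfA (c 0) P), (halfB (c 0) P); split => //.
apply: uniq => //; [by rewrite h1 h2; field|exact: halfAB|].
rewrite scalerDl scalerBl addrACA -scalerDr -scalerBr halfAB_muli -muliD halfAB.
by rewrite /P scalerA divff// scale1r /p addrC subrK.
Qed.

End Connection.

(** * Hermitian product of two points of a geodesic *)

Section Chord.
Variables (R : realType) (n : nat).
Local Notation V := (Cspace R n).
Implicit Types (z w u v q P : V) (x y k dl r tau : R).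

(** The Hermitian product of two points, at times differing by [tau], of the
    geodesic with frequencies [1/2 + dl], [1/2 - dl] whose amplitudes have squared
    norms [(1 + r) / 2] and [(1 - r) / 2]; see [twofreq_chord]. *)
Definition chord dl r tau : R[i] :=
  expi (tau / 2) * (cos (dl * tau) +i* (r * sin (dl * tau))).

Lemma hdotDl u v w : hdot (u + v) w = hdot u w + hdot v w.
Proof. by rewrite !hdotE !gDl. Qed.

Lemma hdotDr u v w : hdot w (u + v) = hdot w u + hdot w v.
Proof. by rewrite !hdotE muliD !gDr. Qed.

Lemma hdot_crot2 x y u v : hdot (crot x u) (crot y v) = expi (x - y) * hdot u v.
Proof. by rewrite -{1}(subrK y x) addrC -crotK hdot_crot hdot_crot_l. Qed.

Lemma twofreq_chord dl r (A B : V) (t s : R) :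
  g A A = (1 + r) / 2 -> g B B = (1 - r) / 2 -> g A B = 0 -> g A (muli B) = 0 ->
  hdot (twofreq (2^-1 + dl) (2^-1 - dl) A B t) (twofreq (2^-1 + dl) (2^-1 - dl) A B s)
  = chord dl r (t - s).
Proof.
move=> AA BB AB AJB.
have hAB : hdot A B = 0 by rewrite hdotE AB AJB.
have hBA : hdot B A = 0 by rewrite hdotE gC AB gC g_muli_l AJB oppr0.
have hAA : hdot A A = ((1 + r) / 2)%:C by rewrite hdotE AA g_muli_r.
have hBB : hdot B B = ((1 - r) / 2)%:C by rewrite hdotE BB g_muli_r.
rewrite /twofreq hdotDl !hdotDr !hdot_crot2 hAB hBA hAA hBB !mulr0 addr0 add0r.
rewrite -!mulrBr !mulrDl expiD mulNr expiD -!mulrA -mulrDr /chord.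
rewrite [2^-1 * _]mulrC; congr (_ * _).
rewrite /expi cosN sinN; apply/eqP; rewrite eq_complex /=.
by apply/andP; split; apply/eqP; field.
Qed.

Lemma connecting_chord k q0 q1 : connecting_geodesics k q0 q1 !=set0 ->
  exists dl r tau, [/\ 0 <= dl, -1 <= r <= 1, 2 * k = 4^-1 + dl ^+ 2 + dl * r &
    hdot q0 q1 = chord dl r tau].
Proof.
move=> [c [geo Ek [s [T [<- <-]]]]].
have [dl [r [A [B [dl0 AA BB [AB AJB] cE]]]]] := geodesic_twofreq geo.
exists dl, r, (s - T / 2 - (s + T / 2)); split => //.
- by have := g_ge0 A; have := g_ge0 B; rewrite AA BB => h1 h2; apply/andP; split; lra.
- have [|||| _ /(_ 0)] := @twofreq_geodesic R n (2^-1 + dl) (2^-1 - dl) A B => //.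
  + by field.
  + by rewrite AA BB; field.
  by rewrite -cE Ek AA BB => ->; field.
- by rewrite cE; exact: twofreq_chord.
Qed.

(** After undoing the rotation by [tau / 2], the vector [q0] must be
    [cos (dl tau) q1 + sin (dl tau) P] for a unit vector [P] normal to [q1] with
    contact momentum [r].  When the sine is not 0 this equation can be solved for
    [P], and the value of [<q0, q1>] says exactly that [P] is as required. *)
Lemma chord_connecting k dl r tau q0 q1 : sphere q0 -> sphere q1 ->
  2 * k = 4^-1 + dl ^+ 2 + dl * r -> hdot q0 q1 = chord dl r tau ->
  sin (dl * tau) != 0 -> connecting_geodesics k q0 q1 !=set0.
Proof.
move=> /sphereE q00 /sphereE q11 kE hE sn0.
pose sn := sin (dl * tau); pose cs := cos (dl * tau).
have cssn : cs ^+ 2 + sn ^+ 2 = 1 by exact: cos2Dsin2.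
pose q0' := crot (- (tau / 2)) q0.
have hE' : hdot q0' q1 = cs +i* (r * sn).
  rewrite hdot_crot_l hE /chord mulrA -expiD addNr /expi cos0 sin0.
  by rewrite mul1r.
(* The solution of the equation q0' = cs *: q1 + sn *: P. *)
pose P := sn^-1 *: (q0' - cs *: q1).
have [g1 g2] : g q0' q1 = cs /\ g q0' (muli q1) = r * sn.
  by move: hE'; rewrite hdotE => -[-> ->].
have g3 : g q0' q0' = 1 by rewrite g_crot.
have PP : g P P = 1.
  have e : g (q0' - cs *: q1) (q0' - cs *: q1) = sn ^+ 2.
    move: (q0') g1 g2 g3 => z g1 g2 g3.
    by rewrite !g_linE (gC q1) g1 g3 q11 -(addKr (cs ^+ 2) (sn ^+ 2)) cssn; ring.
  by rewrite /P gZl gZr e; field.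
have Pq : g P q1 = 0.
  by rewrite /P gZl gDl gNl gZl g1 q11 mulr1 subrr mulr0.
have PJ : g P (muli q1) = r.
  by rewrite /P gZl gDl gNl gZl g2 g_muli_r; field.
have PE : q0 = crot (tau / 2) (cs *: q1 + sn *: P).
  by rewrite /P scalerA divff// scale1r addrC subrK /q0' crotK subrr crot0.
have [AA BB AB AJB] := half_gram q11 PP Pq PJ.
exists (twofreq (2^-1 + dl) (2^-1 - dl) (halfA q1 P) (halfB q1 P)).
have [||||geo en] := @twofreq_geodesic R n (2^-1 + dl) (2^-1 - dl) (halfA q1 P) (halfB q1 P) => //.
- by field.
- by rewrite AA BB; field.
split => //.
- by move=> t; rewrite en AA BB -[k](mulKf (x:=2))// kE; field.
- exists (tau / 2), (- tau); split; last first.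
    rewrite mulNr subrr /twofreq !mulr0 !crot0; exact: halfAB.
  rewrite mulNr opprK -splitr /twofreq !mulrDl !(mulrC _ tau) mulrN -!crotK -crotD.
  rewrite PE; congr crot.
  rewrite !crotE cosN sinN !(mulrC tau) -/cs -/sn addrACA -scalerDr halfAB.
  by rewrite scaleNr -scalerBr halfAB_muli.
Qed.

(** Points with Hermitian product of modulus 1 lie on a common Reeb orbit, and
    Reeb orbits run at any constant speed are magnetic geodesics. *)
Lemma reeb_connecting k phi q0 q1 : sphere q0 -> sphere q1 -> 0 < k ->
  hdot q0 q1 = expi phi -> connecting_geodesics k q0 q1 !=set0.
Proof.
move=> /sphereE q00 /sphereE q11 k0 hE.
have q0E : q0 = crot phi q1.
  apply/eqP; rewrite -subr_eq0; apply/eqP; apply: g_eq0.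
  move: hE; rewrite hdotE /expi => -[h1 h2].
  rewrite -scaleN1r g_sqrD gZl !gZr g_crot q00 q11 crotE gDr !gZr h1 h2 -!expr2 cos2Dsin2; ring.
(* A one-frequency curve of energy k: only the amplitude of frequency w is not 0. *)
pose w := Num.sqrt (2 * k).
have w0 : 0 < w by rewrite sqrtr_gt0 mulr_gt0.
have w2 : w ^+ 2 = 2 * k by rewrite sqr_sqrtr// ltW// mulr_gt0.
exists (twofreq w (1 - w) q1 0).
have [||||geo en] := @twofreq_geodesic R n w (1 - w) q1 0 => //.
- by rewrite addrC subrK.
- by rewrite q11 g0r addr0.
- by rewrite g0r.
- by rewrite /muli /= oppr0 -[(0, 0)]/(0 : V) g0r.
split => //.
- by move=> t; rewrite en q11 g0r w2; field.
- exists (phi / w / 2), (- (phi / w)); split.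
    rewrite mulNr opprK -splitr /twofreq crot_zero addr0 q0E; congr crot.
    by rewrite mulrC divfK// gt_eqF.
  by rewrite mulNr subrr /twofreq !mulr0 !crot0 addr0.
Qed.

End Chord.

(** * Solving for a prescribed modulus and phase *)

Section Phase.
Variable R : realType.
Implicit Types (x y k dl r tau rho phi : R) (m : int).

Lemma sin_intpi m : sin (m%:~R * pi) = 0 :> R.
Proof.
have nat j : sin (j%:R * pi) = 0 :> R.
  elim: j => [|j IH]; first by rewrite mul0r sin0.
  by rewrite -natr1 mulrDl mul1r sinDpi IH oppr0.
case: m => j; first exact: nat.
by rewrite NegzE mulrNz mulNr sinN nat oppr0.
Qed.

Lemma cos_intpi_sqr m : cos (m%:~R * pi) ^+ 2 = 1 :> R.
Proof. by rewrite cos2sin2 sin_intpi expr0n subr0. Qed.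

Lemma expi_int2pi x m : expi (x + m%:~R * (pi *+ 2)) = expi x.
Proof.
have e : expi (m%:~R * (pi *+ 2)) = 1 :> R[i].
  rewrite mulrnAr mulr2n expiD /expi sin_intpi; apply/eqP.
  by rewrite eq_complex /= !mulr0 subr0 mul0r addr0 -expr2 cos_intpi_sqr !eqxx.
by rewrite expiD e mulr1.
Qed.

Lemma cos_eq0 x : cos x = 0 -> exists m, x = pi / 2 + m%:~R * pi.
Proof.
move=> cx; pose m := Num.floor (x / pi).
have pi0 := pi_gt0 R.
have /andP[h1 h2] : m%:~R <= x / pi < (m + 1)%:~R by exact: floor_itv.
exists m; pose y := x - m%:~R * pi.
have y0 : 0 <= y by rewrite subr_ge0 -ler_pdivlMr.
have ypi : y <= pi.
  rewrite lerBlDr -[X in X + _]mul1r -mulrDl -ler_pdivrMr//.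
  by rewrite ltW// addrC -intrD1.
have cy : cos y = 0.
  by rewrite /y cosB cx mul0r sin_intpi mulr0 addr0.
have : y = pi / 2.
  apply: cos_inj; rewrite ?cos_pihalf// in_itv /=; first by rewrite y0.
  by apply/andP; split; lra.
by rewrite /y => <-; rewrite subrK.
Qed.

Lemma complex_polar (x y : R) : exists phi, x +i* y = (Num.sqrt (x ^+ 2 + y ^+ 2))%:C * expi phi.
Proof.
have [e|ne] := eqVneq (x ^+ 2 + y ^+ 2) 0.
  exists 0; rewrite e sqrtr0 mul0r.
  have /eqP := e; rewrite paddr_eq0 ?sqr_ge0// !sqrf_eq0 => /andP[/eqP-> /eqP->].
  by [].
set rho := Num.sqrt _.
have rho0 : 0 < rho by rewrite sqrtr_gt0 lt_neqAle eq_sym ne addr_ge0 ?sqr_ge0.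
have rho2 : rho ^+ 2 = x ^+ 2 + y ^+ 2 by rewrite sqr_sqrtr// addr_ge0 ?sqr_ge0.
have xr : (x / rho) ^+ 2 + (y / rho) ^+ 2 = 1.
  by rewrite !expr_div_n -mulrDl -rho2 divff// expf_neq0// gt_eqF.
have x1 : -1 <= x / rho <= 1.
  rewrite -ler_norml -(@ler_pXn2r _ 2)// ?nnegrE// expr1n real_normK ?num_real//.
  by rewrite -xr lerDl sqr_ge0.
have s2 : sin (acos (x / rho)) = `|y / rho|.
  by rewrite sin_acos// -xr addrAC subrr add0r sqrtr_sqr.
have [y0|y0] := leP 0 y.
  exists (acos (x / rho)); rewrite /expi acosK ?in_itv// s2 ger0_norm;
    last by rewrite divr_ge0// ltW.
  by apply/eqP; rewrite eq_complex /=; apply/andP; split; apply/eqP; field; exact: lt0r_neq0.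
exists (- acos (x / rho)); rewrite /expi cosN sinN acosK ?in_itv//
  s2 ltr0_norm ?pmulr_llt0 ?invr_gt0//.
by apply/eqP; rewrite eq_complex /=; apply/andP; split; apply/eqP; field; exact: lt0r_neq0.
Qed.

(** [s] is the value of [sin (dl tau)] for which a chord of parameter [r] has
    modulus [rho], because the squared modulus is [1 - (1 - r^2) sin^2]. *)
Lemma sqrt_ratio_bounds rho r : 0 < rho < 1 -> r ^+ 2 < rho ^+ 2 ->
  let s := Num.sqrt ((1 - rho ^+ 2) / (1 - r ^+ 2)) in
  [/\ 0 < s, s < 1, s ^+ 2 * (1 - r ^+ 2) = 1 - rho ^+ 2 & -1 < r * s / rho < 1].
Proof.
move=> /andP[rho0 rho1] rr s.
have rho2 : rho ^+ 2 < 1 by rewrite expr_lt1// ltW.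
have p1 : 0 < 1 - rho ^+ 2 by rewrite subr_gt0.
have p2 : 0 < 1 - r ^+ 2 by rewrite subr_gt0 (lt_trans rr).
have s0 : 0 < s by rewrite sqrtr_gt0 divr_gt0.
have sE : s ^+ 2 * (1 - r ^+ 2) = 1 - rho ^+ 2.
  by rewrite sqr_sqrtr ?divfK ?gt_eqF// divr_ge0 ?ltW.
have s1 : s < 1.
  rewrite -(@ltr_pXn2r _ 2)// ?nnegrE ?ltW// expr1n.
  by rewrite -(@ltr_pM2r _ (1 - r ^+ 2))// sE mul1r; lra.
split => //; rewrite -ltr_norml -(@ltr_pXn2r _ 2)// ?nnegrE// expr1n.
rewrite real_normK ?num_real// expr_div_n ltr_pdivrMr ?exprn_gt0// mul1r exprMn.
apply: le_lt_trans rr; rewrite ler_piMr ?sqr_ge0// expr_le1 ?ltW//.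
Qed.

(** The chord with [sin (dl tau) = s] and nonnegative cosine, stripped of its
    factor [e^(i tau / 2)], in polar form. *)
Lemma polar_asin rho r : 0 < rho < 1 -> r ^+ 2 < rho ^+ 2 ->
  let s := Num.sqrt ((1 - rho ^+ 2) / (1 - r ^+ 2)) in
  cos (asin s) +i* (r * sin (asin s)) = rho%:C * expi (asin (r * s / rho)).
Proof.
move=> rho01 rr s; have [s0 s1 sE /andP[u1 u2]] := sqrt_ratio_bounds rho01 rr.
rewrite -/s in s0 s1 sE u1 u2; have /andP[rho0 rho1] := rho01.
have hs : -1 <= s <= 1 by rewrite (ltW s1) andbT (le_trans _ (ltW s0))// lerN10.
have hu : -1 <= r * s / rho <= 1 by rewrite !ltW.
rewrite /expi !cos_asin// !asinK ?in_itv//=.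
apply/eqP; rewrite eq_complex /= !mul0r subr0 addr0; apply/andP; split; apply/eqP.
  have -> : 1 - s ^+ 2 = rho ^+ 2 * (1 - (r * s / rho) ^+ 2).
    have -> : rho ^+ 2 * (1 - (r * s / rho) ^+ 2) = rho ^+ 2 - r ^+ 2 * s ^+ 2.
      by field; exact: lt0r_neq0.
    by move: sE; lra.
  by rewrite sqrtrM ?sqr_ge0// sqrtr_sqr ger0_norm// ltW.
by field; exact: lt0r_neq0.
Qed.

(** For given [k], the energy relation makes [r] a function of [dl].  The
    condition [|r| < rho] holds on an interval of [dl] around the square root of
    [K + rho^2 / 2], where [K = 2 k - 1/4].  There the modulus fixes
    [sin (dl tau)], say [dl tau = asin s + 2 pi j], and the phase of the chord is
    [G dl + j pi / dl] with [G] bounded.  For large [j] this function of [dl]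
    spans more than [2 pi], so the intermediate value theorem gives the phase
    [phi]. *)
Lemma chord_phase k rho phi : 0 < rho < 1 -> 1 - 8 * k < rho ^+ 2 ->
  exists dl r tau, [/\ 2 * k = 4^-1 + dl ^+ 2 + dl * r,
    chord dl r tau = rho%:C * expi phi & sin (dl * tau) != 0].
Proof.
move=> rho01 krho; have /andP[rho0 rho1] := rho01.
pose K := 2 * k - 4^-1.
(* With x = dl^2, the inequality r^2 < rho^2 reads (K - x)^2 < rho^2 x, that is
(x - xs)^2 < eps^2. *)
pose xs := K + rho ^+ 2 / 2.
pose eps2 := rho ^+ 2 * (rho ^+ 2 + 4 * K) / 4.
have eps2_gt0 : 0 < eps2.
  by rewrite divr_gt0// mulr_gt0 ?exprn_gt0// /K; lra.
pose eps := Num.sqrt eps2.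
have eps0 : 0 < eps by rewrite sqrtr_gt0.
have epsE : eps ^+ 2 = eps2 by rewrite sqr_sqrtr// ltW.
have rhosq : 0 < rho ^+ 2 by rewrite exprn_gt0.
have id x : rho ^+ 2 * x - (K - x) ^+ 2 = eps ^+ 2 - (x - xs) ^+ 2.
  by rewrite epsE /eps2 /xs; field.
have xs0 : 0 < xs.
  rewrite -(pmulr_rgt0 _ rhosq); have := id xs; rewrite subrr expr0n subr0 => h.
  have := sqr_ge0 (K - xs); have := exprn_gt0 2 eps0; lra.
pose d1 := Num.sqrt xs; pose d2 := Num.sqrt (xs + eps / 2).
have d1_gt0 : 0 < d1 by rewrite sqrtr_gt0.
have d12 : d1 < d2 by rewrite ltr_sqrt; lra.
pose r d := (K - d ^+ 2) / d.
have good d : d1 <= d <= d2 -> 0 < d /\ r d ^+ 2 < rho ^+ 2.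
  move=> /andP[h1 h2]; have d0 := lt_le_trans d1_gt0 h1; split => //.
  have e1 : xs <= d ^+ 2.
    by rewrite -[xs]sqr_sqrtr ?(ltW xs0)// ler_pXn2r// nnegrE ltW.
  have e2 : d ^+ 2 <= xs + eps / 2.
    rewrite -[_ + eps / 2]sqr_sqrtr ?ler_pXn2r// ?nnegrE ?(ltW d0) ?sqrtr_ge0//; lra.
  rewrite /r expr_div_n ltr_pdivrMr ?exprn_gt0// -subr_gt0 id subr_gt0.
  by rewrite ltr_pXn2r// ?nnegrE; lra.
pose s d := Num.sqrt ((1 - rho ^+ 2) / (1 - r d ^+ 2)).
pose u d := r d * s d / rho.
pose G d := asin (s d) / d / 2 + asin (u d).
pose f j d := G d + j * (pi / d).
have fcont j d : d1 <= d <= d2 -> {for d, continuous (f j)}.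
  move=> /good [d0 rr]; have [s0 s1 sE u1] := sqrt_ratio_bounds rho01 rr.
  have dn0 : d != 0 by rewrite gt_eqF.
  have ci : (fun x => x^-1) @ d --> d^-1 by exact: inv_continuous.
  have cr : r x @[x --> d] --> r d.
    apply: cvgM => //; apply: cvgB; first exact: cvg_cst.
    exact: exprn_continuous.
  have c1 : 1 - r x ^+ 2 @[x --> d] --> 1 - r d ^+ 2.
    by apply: cvgB; [exact: cvg_cst|exact: (cvgM cr cr)].
  have c2 : (1 - r x ^+ 2)^-1 @[x --> d] --> (1 - r d ^+ 2)^-1.
    apply: cvgV c1; rewrite gt_eqF// subr_gt0 (lt_trans rr)// expr_lt1//.
    exact: ltW.
  have cs : s x @[x --> d] --> s d.
    by apply: continuous_cvg (cvgM (cvg_cst _) c2); exact: sqrt_continuous.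
  have cu : u x @[x --> d] --> u d.
    by apply: cvgM; [apply: cvgM|exact: cvg_cst].
  have cas : asin (s x) @[x --> d] --> asin (s d).
    apply: continuous_cvg cs; apply: continuous_asin.
    by rewrite s1 andbT (lt_trans _ s0)// ltrN10.
  have cau : asin (u x) @[x --> d] --> asin (u d).
    by apply: continuous_cvg cu; apply: continuous_asin.
  apply: cvgD; last by apply: cvgM; [exact: cvg_cst|apply: cvgM; [exact: cvg_cst|]].
  by apply: cvgD => //; apply: cvgM; [apply: cvgM|exact: cvg_cst].
(* By how much j pi / dl decreases from d1 to d2, per unit of j. *)
pose gap := pi * (d1^-1 - d2^-1).
have gap0 : 0 < gap.
  by rewrite mulr_gt0 ?pi_gt0// subr_gt0 ltf_pV2 ?posrE// (lt_trans d1_gt0).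
pose need := `|(pi *+ 2 + G d2 - G d1) / gap|.
pose j := Num.bound need.
have jP : pi *+ 2 + G d2 - G d1 <= j%:R * gap.
  rewrite -ler_pdivrMr//; apply: le_trans (ler_norm _) _; apply: ltW.
  by apply: archi_boundP; exact: normr_ge0.
have fgap : f j%:R d2 + pi *+ 2 <= f j%:R d1.
  by move: jP; rewrite /f /gap !mulrBr !mulrA; lra.
(* The number of turns that brings phi between the two end values of the phase. *)
pose N := Num.floor ((f j%:R d1 - phi) / (pi *+ 2)).
have tp : 0 < pi *+ 2 :> R by rewrite pmulrn_lgt0// pi_gt0.
have /andP[N1 N2] : N%:~R <= (f j%:R d1 - phi) / (pi *+ 2) < (N + 1)%:~R by exact: floor_itv.
rewrite ler_pdivlMr// in N1; rewrite ltr_pdivrMr// intrD1 mulrDl mul1r in N2.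
have [d dI fd] : exists2 d, d \in `[d1, d2] & f j%:R d = phi + N%:~R * (pi *+ 2).
  apply: IVT; first exact: ltW.
    apply: continuous_in_subspaceT => d; rewrite inE /= in_itv /= => h; exact: fcont.
  apply/andP; split.
    by rewrite ge_min; apply/orP; right; lra.
  by rewrite le_max; apply/orP; left; lra.
rewrite in_itv /= in dI; have [d0 rr] := good d dI.
pose psi := asin (s d) + (j%:Z)%:~R * (pi *+ 2).
have dn0 : d != 0 by rewrite gt_eqF.
exists d, (r d), (psi / d); split.
- by rewrite /r /K; field.
- rewrite /chord [d * _]mulrC divfK//.
  have -> : cos psi +i* (r d * sin psi) = rho%:C * expi (asin (u d)).
    rewrite -polar_asin//; have := expi_int2pi (asin (s d)) (j%:Z); rewrite -/psi /expi -/(s d).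
    by move=> [-> ->].
  rewrite mulrCA -expiD; congr (_ * _).
  have -> : psi / d / 2 + asin (u d) = f j%:R d.
    by rewrite /f /G /psi -mulr_natr; field.
  by rewrite fd expi_int2pi.
- rewrite [d * _]mulrC divfK//.
  have := expi_int2pi (asin (s d)) (j%:Z); rewrite -/psi /expi => -[_ ->].
  have [s0 s1 sE u1] := sqrt_ratio_bounds rho01 rr.
  by rewrite asinK ?gt_eqF// in_itv /= (ltW s1) andbT (le_trans _ (ltW s0))// lerN10.
Qed.

End Phase.

(** * Which pairs of points are connected *)

Section Connecting.
Variables (R : realType) (n : nat).
Local Notation V := (Cspace R n).
Implicit Types (q : V) (x y k dl r tau : R) (z : R[i]).

(** The squared modulus as a real number, where inequalities can be solved;
    [`|z|] has a complex type. *)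
Definition sqnorm z : R := complex.Re z ^+ 2 + complex.Im z ^+ 2.

Lemma normc_sqnorm z : `|z| = (Num.sqrt (sqnorm z))%:C.
Proof. exact: normc_def. Qed.

Lemma sqnorm_ge0 z : 0 <= sqnorm z.
Proof. by rewrite addr_ge0 ?sqr_ge0. Qed.

Lemma sqnorm_eq0 z : sqnorm z = 0 -> z = 0.
Proof.
move=> /eqP; rewrite paddr_eq0 ?sqr_ge0// !sqrf_eq0 => /andP[/eqP h1 /eqP h2].
by apply/eqP; rewrite eq_complex h1 h2 !eqxx.
Qed.

Lemma sqnorm_expi x z : sqnorm (expi x * z) = sqnorm z.
Proof.
rewrite /sqnorm /expi; case: z => a b /=.
have -> : (cos x * a - sin x * b) ^+ 2 + (cos x * b + sin x * a) ^+ 2 =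
  (cos x ^+ 2 + sin x ^+ 2) * (a ^+ 2 + b ^+ 2) by ring.
by rewrite cos2Dsin2 mul1r.
Qed.

(** Bessel inequality for the orthonormal pair [q1], [i q1]. *)
Lemma hdot_sqnorm_le1 q0 q1 : sphere q0 -> sphere q1 -> sqnorm (hdot q0 q1) <= 1.
Proof.
move=> /sphereE q00 /sphereE q11; rewrite hdotE /sqnorm /=.
have := g_ge0 (q0 - g q0 q1 *: q1 - g q0 (muli q1) *: muli q1).
rewrite !g_linE (gC q1 q0) (gC (muli q1) q0) (gC (muli q1) q1) g_muli_r q00 q11.
lra.
Qed.

(** The modulus with [dl] and [tau] separated from [k]: both correction terms to
    [1 - 8 k] are nonnegative when [|r| <= 1], which is the source of the
    threshold. *)
Lemma chord_sqnorm k dl r tau : 2 * k = 4^-1 + dl ^+ 2 + dl * r ->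
  sqnorm (chord dl r tau) =
  1 - 8 * k + (r + 2 * dl) ^+ 2 + (1 - r ^+ 2) * cos (dl * tau) ^+ 2.
Proof.
move=> kE; rewrite /chord sqnorm_expi /sqnorm /= exprMn sin2cos2.
have -> : 8 * k = 4 * (2 * k) by ring.
by rewrite kE; field.
Qed.

Lemma connecting_sqnorm_ge k q0 q1 : connecting_geodesics k q0 q1 !=set0 ->
  1 - 8 * k <= sqnorm (hdot q0 q1).
Proof.
move=> /connecting_chord [dl [r [tau [dl0 r1 kE ->]]]].
rewrite (chord_sqnorm _ kE) -addrA lerDl addr_ge0 ?sqr_ge0// mulr_ge0 ?sqr_ge0//.
by rewrite subr_ge0 -[r ^+ 2]real_normK ?num_real// expr_le1// ler_norml.
Qed.

Lemma connecting_exists k q0 q1 : sphere q0 -> sphere q1 -> 0 < k ->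
  1 - 8 * k < sqnorm (hdot q0 q1) -> 0 < sqnorm (hdot q0 q1) \/ 8^-1 < k ->
  connecting_geodesics k q0 q1 !=set0.
Proof.
move=> q0S q1S k0 hk hpos.
have le1 := hdot_sqnorm_le1 q0S q1S.
have [phi hE] : exists phi, hdot q0 q1 = (Num.sqrt (sqnorm (hdot q0 q1)))%:C * expi phi.
  by rewrite /sqnorm; case: (hdot q0 q1) => a b /=; exact: complex_polar.
have sq := sqr_sqrtr (sqnorm_ge0 (hdot q0 q1)).
move: sq hE hk hpos le1; set N := sqnorm _; set rho := Num.sqrt N => sq hE hk hpos le1.
have rho0 : 0 <= rho by exact: sqrtr_ge0.
have [N1|N1] := eqVneq N 1.
  apply: (@reeb_connecting _ _ k phi) => //.
  by rewrite hE /rho N1 sqrtr1 mul1r.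
have [N0|N0] := eqVneq N 0.
  (* Hermitian product 0: a chord with r = 0 and dl tau = pi / 2. *)
  have k8 : 8^-1 < k by case: hpos => //; rewrite N0 ltxx.
  have dl0 : 0 < 2 * k - 4^-1 by lra.
  pose dl := Num.sqrt (2 * k - 4^-1).
  have dlp : dl != 0 by rewrite gt_eqF// sqrtr_gt0.
  have dt : dl * (pi / 2 / dl) = pi / 2 by rewrite mulrC divfK.
  apply: (@chord_connecting _ _ k dl 0 (pi / 2 / dl)) => //.
  - by rewrite mulr0 addr0 sqr_sqrtr ?ltW//; ring.
  - by rewrite hE /rho N0 sqrtr0 mul0r /chord dt cos_pihalf mul0r mulr0.
  - by rewrite dt sin_pihalf oner_eq0.
have N00 : 0 < N by rewrite lt_neqAle eq_sym N0 sqnorm_ge0.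
have rho01 : 0 < rho < 1.
  rewrite sqrtr_gt0 N00 /= -sqrtr1 ltr_sqrt// lt_neqAle N1 le1 //.
have [|dl [r [tau [kE cE sn]]]] := @chord_phase R k rho phi rho01; first by rewrite sq.
by apply: (@chord_connecting _ _ k dl r tau) => //; rewrite hE cE.
Qed.

(** If [<q0, q1> = 0] at the critical energy, [chord_sqnorm] gives [r = - 2 dl],
    and the energy relation then gives [dl = 0]: the geodesic is a Reeb orbit, all
    of whose chords have modulus 1. *)
Lemma connecting_critical q0 q1 : sphere q0 -> sphere q1 ->
  connecting_geodesics 8^-1 q0 q1 !=set0 <-> hdot q0 q1 <> 0.
Proof.
move=> q0S q1S; split=> [|ne]; last first.
  have N0 : 0 < sqnorm (hdot q0 q1).
    by rewrite lt_neqAle sqnorm_ge0 andbT eq_sym; apply/eqP => /sqnorm_eq0.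
  by apply: connecting_exists => //; [lra | left].
move=> /connecting_chord [dl [r [tau [dl0 r1 kE ->]]]] c0.
have := chord_sqnorm tau kE; rewrite c0 {1}/sqnorm /= expr0n /= addr0 => e.
have p1 : 0 <= (1 - r ^+ 2) * cos (dl * tau) ^+ 2.
  rewrite mulr_ge0 ?sqr_ge0//.
  by rewrite subr_ge0 -[r ^+ 2]real_normK ?num_real// expr_le1// ler_norml.
have p2 := sqr_ge0 (r + 2 * dl).
have e2 : (r + 2 * dl) ^+ 2 = 0 by lra.
have {e2} e2 : r = - (2 * dl) by move/eqP: e2; rewrite sqrf_eq0 addr_eq0 => /eqP.
have {}dl0 : dl = 0.
  by apply/eqP; rewrite -sqrf_eq0; apply/eqP; move: kE; rewrite e2; lra.
by move: e; rewrite e2 dl0 mulr0 oppr0 mul0r cos0 addr0 !expr0n !expr1n /=; lra.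
Qed.

(** On the threshold [dl = sqrt (1/4 - 2 k)], [r = - 2 dl] and
    [dl tau = pi / 2 + m pi]; [shift_a] and [shift_b] are the constant term and
    the step of the resulting phase of the chord, as computed in [chord_shift]. *)
Definition shift_a k : R := pi / (4 * Num.sqrt (4^-1 - 2 * k)) - pi / 2.
Definition shift_b k : R := pi / (2 * Num.sqrt (4^-1 - 2 * k)) + pi.

Lemma shift_b_gt0 k : 0 < shift_b k.
Proof.
by rewrite /shift_b ltr_wpDl ?pi_gt0// divr_ge0 ?pi_ge0// mulr_ge0// sqrtr_ge0.
Qed.

Lemma chord_shift k (m : int) : 0 < k -> k < 8^-1 ->
  let dl := Num.sqrt (4^-1 - 2 * k) in
  chord dl (- (2 * dl)) ((pi / 2 + m%:~R * pi) / dl) =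
  expi (shift_a k + m%:~R * shift_b k) * (Num.sqrt (1 - 8 * k))%:C.
Proof.
move=> k0 k8 dl.
have dl0 : 0 < dl by rewrite sqrtr_gt0; lra.
have -> : Num.sqrt (1 - 8 * k) = 2 * dl.
  rewrite -[2 * dl]ger0_norm ?mulr_ge0 ?(ltW dl0)// -sqrtr_sqr exprMn sqr_sqrtr; last lra.
  by congr Num.sqrt; field.
have dt : dl * ((pi / 2 + m%:~R * pi) / dl) = pi / 2 + m%:~R * pi.
  by rewrite mulrC divfK// gt_eqF.
rewrite /chord dt.
have -> : shift_a k + m%:~R * shift_b k =
   (pi / 2 + m%:~R * pi) / dl / 2 + (m%:~R * pi - pi / 2).
  by rewrite /shift_a /shift_b -/dl; field; exact: lt0r_neq0.
rewrite expiD -[RHS]mulrA; congr (_ * _).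
rewrite [pi / 2 + _]addrC /expi cosDpihalf sinDpihalf cosBpihalf sinBpihalf sin_intpi.
by apply/eqP; rewrite eq_complex /=; apply/andP; split; apply/eqP; ring.
Qed.

Lemma connecting_subcritical k q0 q1 : sphere q0 -> sphere q1 -> 0 < k -> k < 8^-1 ->
  [/\ (Num.sqrt (1 - 8 * k))%:C < `|hdot q0 q1| -> connecting_geodesics k q0 q1 !=set0,
      `|hdot q0 q1| = (Num.sqrt (1 - 8 * k))%:C ->
        (connecting_geodesics k q0 q1 !=set0 <->
         exists m : int, hdot q0 q1 =
           expi (shift_a k + m%:~R * shift_b k) * (Num.sqrt (1 - 8 * k))%:C) &
      `|hdot q0 q1| < (Num.sqrt (1 - 8 * k))%:C -> connecting_geodesics k q0 q1 = set0].
Proof.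
move=> q0S q1S k0 k8; have k8' : 0 < 1 - 8 * k by lra.
have sqk := sqr_sqrtr (ltW k8').
rewrite normc_sqnorm; split.
- rewrite ltcR -(@ltr_pXn2r _ 2)// ?nnegrE ?sqrtr_ge0// sqk sqr_sqrtr ?sqnorm_ge0// => h.
  by apply: connecting_exists => //; left; exact: lt_trans h.
- move=> /(congr1 (@complex.Re R)) /= /(congr1 (fun x : R => x ^+ 2));
  rewrite sqr_sqrtr ?sqnorm_ge0// sqk => hE.
  set dl0 := Num.sqrt (4^-1 - 2 * k).
  have dlp : 0 < dl0 by rewrite sqrtr_gt0; lra.
  have dl2 : dl0 ^+ 2 = 4^-1 - 2 * k by rewrite sqr_sqrtr//; lra.
  split=> [|[m mE]]; last first.
    apply: (@chord_connecting _ _ k dl0 (- (2 * dl0)) ((pi / 2 + m%:~R * pi) / dl0)) => //.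
    + by rewrite mulrN mulrCA -expr2 dl2; field.
    + by rewrite mE chord_shift.
    + rewrite [dl0 * _]mulrC divfK; last by rewrite gt_eqF.
      rewrite [pi / 2 + _]addrC sinDpihalf.
      by rewrite -(sqrf_eq0 (cos _)) cos_intpi_sqr oner_eq0.
  move=> /connecting_chord [dl [r [tau [dlge0 r1 kE cE]]]].
  have := chord_sqnorm tau kE; rewrite -cE hE => e.
  have r2 : 0 <= 1 - r ^+ 2.
    by rewrite subr_ge0 -[r ^+ 2]real_normK ?num_real// expr_le1// ler_norml.
  have p1 : 0 <= (1 - r ^+ 2) * cos (dl * tau) ^+ 2 by rewrite mulr_ge0 ?sqr_ge0.
  have p2 := sqr_ge0 (r + 2 * dl).
  have e2 : (r + 2 * dl) ^+ 2 = 0 by lra.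
  have {e2} e2 : r = - (2 * dl) by move/eqP: e2; rewrite sqrf_eq0 addr_eq0 => /eqP.
  have dlE : dl = dl0.
    have d2 : dl ^+ 2 = 4^-1 - 2 * k by rewrite kE e2; ring.
    by rewrite /dl0 -d2 sqrtr_sqr ger0_norm.
  have c0 : cos (dl * tau) = 0.
    apply/eqP; rewrite -sqrf_eq0; apply/eqP.
    have : (1 - r ^+ 2) * cos (dl * tau) ^+ 2 = 0 by lra.
    move/eqP; rewrite mulf_eq0 => /orP[|/eqP//].
    by rewrite e2 sqrrN exprMn dlE dl2 => /eqP; lra.
  have [m mE] := cos_eq0 c0; exists m.
  rewrite cE -chord_shift// -/dl0 -dlE e2; congr chord.
  by rewrite -mE mulrC mulKf// dlE gt_eqF.
- rewrite ltcR => h; apply/seteqP; split => // c cc.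
  have : connecting_geodesics k q0 q1 !=set0 by exists c.
  move=> /connecting_sqnorm_ge; rewrite leNgt; apply: contraNP.
  by rewrite ltr_sqrt// in h.
Qed.

End Connecting.

(** * Differentiating integrals of a one-form over circles *)

Section Green.
Variable R : realType.
Local Notation mu := (@lebesgue_measure R).

Lemma is_derive_comp_curve (U : normedModType R) (b : U -> R^o) (c : R -> U) (t : R) (dc : U) :
  differentiable b (c t) -> is_derive t (1 : R) c dc ->
  is_derive t (1 : R) (b \o c) ('D_dc b (c t)).
Proof.
move=> bd cd.
have cdiff : differentiable c t by apply/derivable1_diffP; exact: ex_derive.
have bc : differentiable (b \o c) t by exact: differentiable_comp.
apply: DeriveDef; first exact/derivable1_diffP.
have dcE : 'd c t 1 = dc by rewrite -deriveE//; exact: derive_val.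
by rewrite deriveE// diff_comp//= dcE -deriveE.
Qed.

Lemma integrable_segment (f : R -> R) (a b : R) : continuous f ->
  mu.-integrable `[a, b] (EFin \o f).
Proof.
move=> cf; apply: continuous_compact_integrable; first exact: segment_compact.
exact: continuous_subspaceT.
Qed.

(** Green's formula in infinitesimal form: if the one-form [Q ds + P dth] has
    exterior derivative [e(s) ds dth] and [Q] has equal values at both ends of a
    circle of length [T], then the integral of [P] over that circle has derivative
    [T e(s)], because the [dQ] part integrates to 0. *)
Lemma is_derive_strip_integral (P Q dP dQ : R -> R -> R) (e : R -> R) (T : R) : 0 < T ->
  (forall s th : R, is_derive s (1 : R) (P ^~ th) (dP s th)) ->
  (forall s th : R, is_derive th (1 : R) (Q s) (dQ s th)) ->
  (forall s, continuous (P s)) ->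
  continuous (fun p : R * R => dP p.1 p.2) ->
  (forall s, continuous (dQ s)) ->
  (forall s th, dP s th = dQ s th + e s) ->
  (forall s, Q s T = Q s 0) ->
  forall s : R, is_derive s (1 : R)
    (fun s => \int[mu]_(th in `[0, T]) P s th) (T * e s).
Proof.
move=> T0 Pd Qd Pc dPc dQc PQ Qper s.
pose K : set (R * R) := `[s - 1, s + 1] `*` `[0, T].
have Kc : compact K by apply: compact_setX; exact: segment_compact.
have K0 : K !=set0 by exists (s, 0); split; rewrite /= in_itv /=; lra.
have nc : {within K, continuous (fun p : R * R => `|dP p.1 p.2|)}.
  apply: continuous_subspaceT => p; apply: cvg_norm; exact: dPc.
have [p0 _ p0max] := compact_EVT_max K0 Kc nc.
(* A constant function dominates the partial derivative near s. *)
pose G := `|dP p0.1 p0.2|.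
have Is : `]s - 1, s + 1[%classic s by rewrite /= in_itv /=; lra.
have partialE x y : partial1of2 P x y = dP x y.
  by rewrite partial1of2E; exact: derive_val.
have intP x : mu.-integrable `[0, T] (EFin \o P x) by exact: integrable_segment.
have derP x y : derivable (P ^~ y) x 1 by exact: ex_derive.
have mI : measurable `[0, T]%classic by exact: measurable_itv.
have ub x y : `]s - 1, s + 1[%classic x -> `[0, T]%classic y -> `|partial1of2 P x y| <= G.
  rewrite /= in_itv /= => xI yI; rewrite partialE.
  apply: (p0max (x, y)); rewrite inE; split => //=; rewrite in_itv /=; lra.
have intG : mu.-integrable `[0, T] (EFin \o (fun=> G)).
  by apply: integrable_segment => x; exact: cvg_cst.
have D := @derivable_under_integral R _ _ mu P _ mI s (s - 1) (s + 1) Is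
  (fun x _ => intP x) (fun x y _ _ => derP x y) (fun=> G) (fun=> normr_ge0 _) intG ub.
have E := @differentiation_under_integral R _ _ mu P _ mI s (s - 1) (s + 1) Is
  (fun x _ => intP x) (fun x y _ _ => derP x y) (fun=> G) (fun=> normr_ge0 _) intG ub.
apply: DeriveDef => //; rewrite -derive1E E.
under eq_Rintegral do rewrite partialE PQ.
rewrite RintegralD//; first last.
- by apply: integrable_segment => x; exact: cvg_cst.
- exact: integrable_segment.
rewrite Rintegral_cst//= lebesgue_measure_itv /= lte_fin T0 /= oppr0 addr0 mulrC.
have -> : \int[mu]_(x in `[0, T]) dQ s x = 0.
  rewrite /Rintegral (@continuous_FTC2 _ _ (Q s)) ?Qper ?subee//.
  - exact: continuous_subspaceT.
  - have Qc : continuous (Q s).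
      move=> x; apply: differentiable_continuous; apply/derivable1_diffP.
      exact: ex_derive.
    split; first by move=> x _; exact: ex_derive.
      by apply: cvg_at_right_filter; exact: Qc.
    by apply: cvg_at_left_filter; exact: Qc.
  - by move=> x _; rewrite derive1E; exact: derive_val.
by rewrite add0r.
Qed.

End Green.

(** * Stokes on a hemisphere bounded by a Reeb orbit *)

Section Hemisphere.
Variables (R : realType) (n : nat).
Local Notation V := (Cspace R n).
Local Notation mu := (@lebesgue_measure R).
Variables (e1 e3 : V).
Hypotheses (e11 : g e1 e1 = 1) (e33 : g e3 e3 = 1) (e13 : g e1 e3 = 0)
  (e23 : g (muli e1) e3 = 0).

Definition frame (a b c : R) : V := a *: e1 + b *: muli e1 + c *: e3.

Lemma g_frame a b c a' b' c' :
  g (frame a b c) (frame a' b' c') = a * a' + b * b' + c * c'.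
Proof.
have e31 : g e3 e1 = 0 by rewrite gC.
have e32 : g e3 (muli e1) = 0 by rewrite gC.
have e21 : g (muli e1) e1 = 0 by rewrite gC g_muli_r.
rewrite /frame !g_linE e11 e33 e13 e23 e31 e32 e21; ring.
Qed.

Lemma g_muli_frame a b c a' b' : g (muli (frame a b c)) (frame a' b' 0) = a * b' - b * a'.
Proof.
have e31 : g e3 e1 = 0 by rewrite gC.
have e32 : g (muli e3) e1 = 0 by rewrite g_muli_l -[RHS]oppr0 gC e23.
have e21 : g (muli e1) e1 = 0 by rewrite gC g_muli_r.
rewrite /frame scale0r addr0 !g_linE e11 e31 e32 e21; ring.
Qed.

Lemma is_derive_frame (a b c : R -> R) (a' b' c' t : R) :
  is_derive t (1 : R) a a' -> is_derive t (1 : R) b b' -> is_derive t (1 : R) c c' ->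
  is_derive t (1 : R) (fun t => frame (a t) (b t) (c t)) (frame a' b' c').
Proof.
by move=> ha hb hc; apply: is_deriveD; [apply: is_deriveD|]; exact: is_derive_scalel.
Qed.

Lemma derive_frame (f : V -> R^o) a b c z : differentiable f z ->
  'D_(frame a b c) f z = a * 'D_e1 f z + b * 'D_(muli e1) f z + c * 'D_e3 f z.
Proof. by move=> fd; rewrite !deriveE// !linearD !linearZ. Qed.

(** The hemisphere with pole [e3], in latitude [s] and longitude [th]; its
    boundary [s = 0] is the Reeb orbit through [e1], and [s = pi / 2] is the
    pole. *)
Definition hemi s th := frame (cos s * cos th) (cos s * sin th) (sin s).
Definition hemi_s s th := frame (- (sin s * cos th)) (- (sin s * sin th)) (cos s).
Definition hemi_t s th := frame (- (cos s * sin th)) (cos s * cos th) 0.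

Lemma is_derive_hemi_s (s th : R) : is_derive s (1 : R) (hemi ^~ th) (hemi_s s th).
Proof.
by apply: is_derive_frame; apply: is_derive_eq; rewrite /GRing.scale /=; ring.
Qed.

Lemma is_derive_hemi_t (s th : R) : is_derive th (1 : R) (hemi s) (hemi_t s th).
Proof.
by apply: is_derive_frame; apply: is_derive_eq; rewrite /GRing.scale /=; ring.
Qed.

Lemma hemi_sphere s th : sphere (hemi s th).
Proof.
apply/sphereE; rewrite g_frame.
have -> : cos s * cos th * (cos s * cos th) + cos s * sin th * (cos s * sin th) + sin s * sin s
  = cos s ^+ 2 * (cos th ^+ 2 + sin th ^+ 2) + sin s ^+ 2 by ring.
by rewrite cos2Dsin2 mulr1 cos2Dsin2.
Qed.

Lemma hemi_s_tangent s th : tangent (hemi s th) (hemi_s s th).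
Proof.
rewrite /tangent /= g_frame.
have -> : cos s * cos th * - (sin s * cos th) + cos s * sin th * - (sin s * sin th) + sin s * cos s
  = sin s * cos s * (1 - (cos th ^+ 2 + sin th ^+ 2)) by ring.
by rewrite cos2Dsin2 subrr mulr0.
Qed.

Lemma hemi_t_tangent s th : tangent (hemi s th) (hemi_t s th).
Proof. rewrite /tangent /= g_frame; ring. Qed.

Lemma g_hemi_area s th : g (muli (hemi_s s th)) (hemi_t s th) = - (sin s * cos s).
Proof.
rewrite g_muli_frame.
have -> : - (sin s * cos th) * (cos s * cos th) - - (sin s * sin th) * - (cos s * sin th)
  = - (sin s * cos s) * (cos th ^+ 2 + sin th ^+ 2) by ring.
by rewrite cos2Dsin2 mulr1.
Qed.

Lemma angle_continuous (f : R -> R) : continuous f ->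
  continuous (fun p : R * R => f p.1) /\ continuous (fun p : R * R => f p.2).
Proof.
move=> fc; split=> p.
  by apply: (@continuous_comp _ _ _ (fst : R * R -> R) f); [exact: cvg_fst|exact: fc].
by apply: (@continuous_comp _ _ _ (snd : R * R -> R) f); [exact: cvg_snd|exact: fc].
Qed.

Lemma hemi_continuous : continuous (fun p : R * R => hemi p.1 p.2).
Proof.
have [c1 c2] := angle_continuous (@continuous_cos R).
have [s1 s2] := angle_continuous (@continuous_sin R).
move=> p; apply: cvgD; last by apply: cvgZr_tmp; exact: s1.
by apply: cvgD; apply: cvgZr_tmp; apply: cvgM; [exact: c1|exact: c2|exact: c1|exact: s2].
Qed.

Variable beta : form1 R n.
Hypothesis beta_prim : primitive (ext_d alpha) beta.

Let b1 z := beta z e1.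
Let b2 z := beta z (muli e1).
Let b3 z := beta z e3.

Lemma beta_frame a b c z : beta z (frame a b c) = a * b1 z + b * b2 z + c * b3 z.
Proof.
have [[L _] _] := beta_prim.
have b0 : beta z 0 = 0 by have := L z (-1) 0 0; rewrite scaler0 addr0; lra.
have LZ x u : beta z (x *: u) = x * beta z u by have := L z x u 0; rewrite addr0 b0 addr0.
by rewrite /frame addrAC -addrA L L LZ addrAC addrA.
Qed.

Lemma beta_smooth v : smooth (fun z => beta z v : R^o).
Proof. by have [[_ S] _] := beta_prim. Qed.

Lemma beta_differentiable v z : differentiable (fun z => beta z v : R^o) z.
Proof. exact: (@beta_smooth v [::] z). Qed.

Lemma beta_continuous v : continuous (fun p : R * R => beta (hemi p.1 p.2) v).
Proof.
move=> p; apply: (@continuous_comp _ _ _ (fun p : R * R => hemi p.1 p.2) (fun z => beta z v : R^o)).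
  exact: hemi_continuous.
exact/differentiable_continuous/beta_differentiable.
Qed.

Lemma Dbeta_continuous u v :
  continuous (fun p : R * R => 'D_u (fun z => beta z v : R^o) (hemi p.1 p.2) : R^o).
Proof.
move=> p; apply: (@continuous_comp _ _ _ (fun p : R * R => hemi p.1 p.2) (fun z => 'D_u
  (fun z => beta z v : R^o) z)).
  exact: hemi_continuous.
exact/differentiable_continuous/(@beta_smooth v [:: u]).
Qed.

(** [lat] and [mer] are the values of [beta] on the longitudinal and meridional
    derivatives [hemi_t] and [hemi_s], that is, the components of the pullback of
    [beta] to the chart; [dlat] and [dmer] are their derivatives in the opposite
    variable. *)
Let lat s th := - (cos s * sin th) * b1 (hemi s th) + cos s * cos th * b2 (hemi s th).
Let mer s th := - (sin s * cos th) * b1 (hemi s th) - sin s * sin th * b2 (hemi s th)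
  + cos s * b3 (hemi s th).
Let dlat s th := sin s * sin th * b1 (hemi s th)
  - cos s * sin th * 'D_(hemi_s s th) (b1 : V -> R^o) (hemi s th)
  - sin s * cos th * b2 (hemi s th)
  + cos s * cos th * 'D_(hemi_s s th) (b2 : V -> R^o) (hemi s th).
Let dmer s th := sin s * sin th * b1 (hemi s th)
  - sin s * cos th * 'D_(hemi_t s th) (b1 : V -> R^o) (hemi s th)
  - sin s * cos th * b2 (hemi s th)
  - sin s * sin th * 'D_(hemi_t s th) (b2 : V -> R^o) (hemi s th)
  + cos s * 'D_(hemi_t s th) (b3 : V -> R^o) (hemi s th).

Lemma is_derive_lat (s th : R) : is_derive s (1 : R) (lat ^~ th) (dlat s th).
Proof.
have d1 : is_derive s (1 : R) (fun s => b1 (hemi s th)) ('D_(hemi_s s th) (b1 : V -> R^o)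
  (hemi s th)).
  by apply: (is_derive_comp_curve _ (is_derive_hemi_s s th)); exact: beta_differentiable.
have d2 : is_derive s (1 : R) (fun s => b2 (hemi s th)) ('D_(hemi_s s th) (b2 : V -> R^o)
  (hemi s th)).
  by apply: (is_derive_comp_curve _ (is_derive_hemi_s s th)); exact: beta_differentiable.
by apply: is_derive_eq; rewrite /dlat /GRing.scale /=; ring.
Qed.

Lemma is_derive_mer (s th : R) : is_derive th (1 : R) (mer s) (dmer s th).
Proof.
have d1 : is_derive th (1 : R) (fun th => b1 (hemi s th)) ('D_(hemi_t s th) (b1 :
  V -> R^o) (hemi s th)).
  by apply: (is_derive_comp_curve _ (is_derive_hemi_t s th)); exact: beta_differentiable.
have d2 : is_derive th (1 : R) (fun th => b2 (hemi s th)) ('D_(hemi_t s th) (b2 :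
  V -> R^o) (hemi s th)).
  by apply: (is_derive_comp_curve _ (is_derive_hemi_t s th)); exact: beta_differentiable.
have d3 : is_derive th (1 : R) (fun th => b3 (hemi s th)) ('D_(hemi_t s th) (b3 :
  V -> R^o) (hemi s th)).
  by apply: (is_derive_comp_curve _ (is_derive_hemi_t s th)); exact: beta_differentiable.
by apply: is_derive_eq; rewrite /dmer /GRing.scale /=; ring.
Qed.

(** The pullback commutes with d: the second derivatives of [hemi] cancel in the
    difference, which leaves [ext_d beta] on [hemi_s] and [hemi_t]; there it equals
    [ext_d alpha]. *)
Lemma dlat_dmer s th : dlat s th = dmer s th - sin s * cos s.
Proof.
have [_ /(_ (hemi s th) (hemi_s s th) (hemi_t s th))] := beta_prim.
move=> /(_ (hemi_sphere s th) (hemi_s_tangent s th) (hemi_t_tangent s th)).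
rewrite ext_d_alphaE g_hemi_area /ext_d.
have D (a b c : R) (u z : V) : 'D_u (fun x => beta x (frame a b c) : R^o) z =
   a * 'D_u (b1 : V -> R^o) z + b * 'D_u (b2 : V -> R^o) z + c * 'D_u (b3 : V -> R^o) z.
  have -> : (fun x => beta x (frame a b c) : R^o) =
      a *: (b1 : V -> R^o) + b *: (b2 : V -> R^o) + c *: (b3 : V -> R^o).
    by apply/funext => x; rewrite beta_frame.
  have dv v : derivable (fun z => beta z v : R^o) z u.
    exact/diff_derivable/beta_differentiable.
  have H := is_deriveD (is_deriveD (is_deriveZ a (derivableP (dv e1)))
    (is_deriveZ b (derivableP (dv (muli e1))))) (is_deriveZ c (derivableP (dv e3))).
  exact: (@derive_val _ _ _ _ _ _ _ H).
have D1 := D (- (cos s * sin th)) (cos s * cos th) 0 (hemi_s s th) (hemi s th).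
have D2 := D (- (sin s * cos th)) (- (sin s * sin th)) (cos s) (hemi_t s th) (hemi s th).
rewrite -/(hemi_t s th) in D1; rewrite -/(hemi_s s th) in D2; rewrite {}D1 {}D2.
rewrite /dlat /dmer.
move: ('D_(hemi_s s th) (b1 : V -> R^o) (hemi s th)) => x1.
move: ('D_(hemi_s s th) (b2 : V -> R^o) (hemi s th)) => x2.
move: ('D_(hemi_s s th) (b3 : V -> R^o) (hemi s th)) => x3.
move: ('D_(hemi_t s th) (b1 : V -> R^o) (hemi s th)) => y1.
move: ('D_(hemi_t s th) (b2 : V -> R^o) (hemi s th)) => y2.
move: ('D_(hemi_t s th) (b3 : V -> R^o) (hemi s th)) => y3.
move: (b1 _) (b2 _) => u1 u2.
move: (sin s) (cos s) (sin th) (cos th) => ss cs st ct.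
by move=> /eqP; rewrite subr_eq => /eqP E;
  rewrite -[- (ss * cs)](addrK (- (ss * ct) * y1 + - (ss * st) * y2 + cs * y3)) -E; ring.
Qed.

Lemma lat_continuous : continuous (fun p : R * R => lat p.1 p.2).
Proof.
have [c1 c2] := angle_continuous (@continuous_cos R).
have [s1 s2] := angle_continuous (@continuous_sin R).
move=> p; apply: cvgD; apply: cvgM; try exact: beta_continuous.
  by apply: cvgN; apply: cvgM; [exact: c1|exact: s2].
by apply: cvgM; [exact: c1|exact: c2].
Qed.

Lemma dlat_continuous : continuous (fun p : R * R => dlat p.1 p.2).
Proof.
have [c1 c2] := angle_continuous (@continuous_cos R).
have [s1 s2] := angle_continuous (@continuous_sin R).
have Dc v : continuous (fun p : R * R =>
    'D_(hemi_s p.1 p.2) (fun z => beta z v : R^o) (hemi p.1 p.2) : R^o).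
  have -> : (fun p : R * R => 'D_(hemi_s p.1 p.2) (fun z => beta z v : R^o) (hemi p.1 p.2) : R^o)
     = (fun p : R * R => - (sin p.1 * cos p.2) * 'D_e1 (fun z => beta z v : R^o) (hemi p.1 p.2)
        + - (sin p.1 * sin p.2) * 'D_(muli e1) (fun z => beta z v : R^o) (hemi p.1 p.2)
        + cos p.1 * 'D_e3 (fun z => beta z v : R^o) (hemi p.1 p.2)).
    by apply/funext => p; rewrite /hemi_s derive_frame//; exact: beta_differentiable.
  move=> p; apply: cvgD; last by apply: cvgM; [exact: c1|exact: Dbeta_continuous].
  apply: cvgD; (apply: cvgM; last exact: Dbeta_continuous); apply: cvgN; apply: cvgM.
  - exact: s1.
  - exact: c2.
  - exact: s1.
  - exact: s2.
move=> p; apply: cvgD; last first.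
  by apply: cvgM; [apply: cvgM; [exact: c1|exact: c2]|exact: Dc].
apply: cvgB; last first.
  by apply: cvgM; [apply: cvgM; [exact: s1|exact: c2]|exact: beta_continuous].
apply: cvgB.
  by apply: cvgM; [apply: cvgM; [exact: s1|exact: s2]|exact: beta_continuous].
by apply: cvgM; [apply: cvgM; [exact: c1|exact: s2]|exact: Dc].
Qed.

(** The circle integrals of [beta] have derivative [- 2 pi sin s cos s], the
    derivative of [pi cos^2 s], and tend to 0 at the pole, where the circle
    degenerates. *)
Lemma circle_integral : \int[mu]_(th in `[0, pi *+ 2]) lat 0 th = pi.
Proof.
have tp : 0 < pi *+ 2 :> R by rewrite pmulrn_lgt0// pi_gt0.
have slice (f : R * R -> R) s : continuous f -> continuous (fun th => f (s, th)).
  move=> fc th; apply: (@continuous_comp _ _ _ (fun th : R => (s, th)) f); last exact: fc.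
  by apply: (@cvg_pair _ _ _ _ (nbhs s) (nbhs th)); [exact: cvg_cst|exact: cvg_id].
have dlatE s th : dlat s th = dmer s th + - (sin s * cos s) by exact: dlat_dmer.
have dmerc s : continuous (dmer s).
  have -> : dmer s = fun th => dlat s th + sin s * cos s.
    by apply/funext => th; rewrite dlat_dmer subrK.
  by move=> th; apply: cvgD; [exact: (slice _ s dlat_continuous)|exact: cvg_cst].
have mer_per s : mer s (pi *+ 2) = mer s 0.
  by rewrite /mer /hemi cos2pi sin2pi cos0 sin0.
have Fd := is_derive_strip_integral tp is_derive_lat is_derive_mer
  (fun s => slice _ s lat_continuous)
  dlat_continuous dmerc dlatE mer_per.
have cd (s : R) : is_derive s (1 : R) (fun s => pi * cos s ^+ 2) (pi *+ 2 * - (sin s * cos s)).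
  by apply: is_derive_eq; rewrite /GRing.scale /=; ring.
have Dd s := is_deriveB (Fd s) (cd s).
pose F s := \int[mu]_(th in `[0, pi *+ 2]) lat s th.
have E : F 0 - pi * cos 0 ^+ 2 = F (pi / 2) - pi * cos (pi / 2) ^+ 2.
  have Z (s : R) : is_derive s (1 : R) (fun s => F s - pi * cos s ^+ 2) 0.
    by apply: is_derive_eq (Dd s) _; rewrite subrr.
  exact: (is_derive_0_is_cst 0 (pi / 2) Z).
have F1 : F (pi / 2) = 0.
  rewrite /F; under eq_Rintegral do rewrite /lat cos_pihalf !mul0r oppr0 mul0r addr0.
  by rewrite Rintegral_cst ?mul0r//; exact: measurable_itv.
by move: E; rewrite F1 cos0 cos_pihalf /F => E; rewrite -[LHS](subrK pi); lra.
Qed.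

(** The boundary circle has unit speed and length [2 pi], so a bound [M] on
    [beta] gives [pi <= 2 pi M]. *)
Lemma circle_bound (M : R) :
  (forall z v, sphere z -> tangent z v -> g v v <= 1 -> beta z v <= M) -> 2^-1 <= M.
Proof.
move=> bM.
have tp : 0 < pi *+ 2 :> R by rewrite pmulrn_lgt0// pi_gt0.
have lat_le th : lat 0 th <= M.
  have -> : lat 0 th = beta (hemi 0 th) (hemi_t 0 th).
    by rewrite beta_frame /lat mul0r addr0.
  apply: bM; [exact: hemi_sphere|exact: hemi_t_tangent|].
  rewrite g_frame cos0 !mul1r mulrNN mulr0 addr0 -!expr2.
  by rewrite addrC cos2Dsin2.
have lat0_cont : continuous (lat 0).
  move=> th; apply: (@continuous_comp _ _ _ (fun th : R => (0 : R, th)) (fun p :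
    R * R => lat p.1 p.2)); last exact: lat_continuous.
  by apply: (@cvg_pair _ _ _ _ (nbhs (0 : R)) (nbhs th)); [exact: cvg_cst|exact: cvg_id].
have mI : measurable `[0, pi *+ 2 : R]%classic by exact: measurable_itv.
have le : \int[mu]_(th in `[0, pi *+ 2]) lat 0 th <= \int[mu]_(th in `[0, pi *+ 2]) M.
  apply: le_Rintegral => //; first exact: integrable_segment.
  by apply: integrable_segment => x; exact: cvg_cst.
move: le; rewrite circle_integral Rintegral_cst//= lebesgue_measure_itv /= lte_fin tp /=.
have -> : M * (pi *+ 2 - 0) = pi * (2 * M) by rewrite subr0 -mulr_natr; ring.
by rewrite -[X in X <= _]mulr1 (ler_pM2l (pi_gt0 R)) => h; lra.
Qed.

End Hemisphere.

(** * The Mane critical value *)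

Section Mane.
Variables (R : realType) (n : nat).
Local Notation V := (Cspace R n).

Definition basis_vector (j : 'I_n.+1) : V := (delta_mx ord0 j, 0).

Lemma g_basis i j : g (basis_vector i) (basis_vector j) = (i == j)%:R.
Proof.
rewrite gE (bigD1 i)//= big1 ?addr0 => [|l li]; rewrite !mxE !eqxx /= ?mulr0 ?mul0r ?addr0.
  by rewrite mul1r eq_sym.
by rewrite (negbTE li) mul0r.
Qed.

Lemma g_muli_basis i j : g (muli (basis_vector i)) (basis_vector j) = 0.
Proof. by rewrite gE big1// => l _; rewrite /= !mxE oppr0 mul0r mulr0 addr0. Qed.

Lemma sphere_basis j : sphere (basis_vector j).
Proof. by apply/sphereE; rewrite g_basis eqxx. Qed.

Lemma alpha_bound (z v : V) : sphere z -> g v v <= 1 -> `|alpha z v| <= 2^-1.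
Proof.
move=> /sphereE z1 v1; rewrite /alpha normrM ger0_norm ?invr_ge0// ler_piMr ?invr_ge0//.
rewrite -(@ler_pXn2r _ 2)// ?nnegrE// expr1n real_normK ?num_real//.
by apply: (le_trans (g_CauchySchwarz (muli z) v)); rewrite g_muli2 z1 mul1r.
Qed.

(** Cauchy-Schwarz bounds [alpha] by [1/2], and the Reeb direction attains the
    bound at every point. *)
Lemma sup_norm_alpha : sup_norm (@alpha R n) = (2^-1)%:E.
Proof.
have pn (z : V) : sphere z -> pointwise_norm alpha z = (2^-1)%:E.
  move=> zS; have z1 := (sphereE z).1 zS; apply/eqP; rewrite eq_le; apply/andP; split.
    apply: ub_ereal_sup => _ [v [_ v1] <-]; rewrite lee_fin; exact: alpha_bound.
  apply: ereal_sup_ubound; exists (muli z).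
    by split; [exact: tangent_muli|rewrite g_muli2 z1].
  by rewrite /alpha g_muli2 z1 mulr1 ger0_norm// invr_ge0.
apply/eqP; rewrite eq_le; apply/andP; split.
  by apply: ub_ereal_sup => _ [z zS <-]; rewrite pn.
by apply: ereal_sup_ubound; exists (basis_vector ord0); [exact: sphere_basis|rewrite pn//;
  exact: sphere_basis].
Qed.

Lemma half_sup_norm_alpha : ((2^-1)%:E * sup_norm (@alpha R n) ^+ 2)%E = (8^-1)%:E.
Proof. by rewrite sup_norm_alpha -EFin_expe -EFinM; congr EFin; field. Qed.

Lemma linear_smooth (f : V -> R^o) :
  (forall (a : R) u v, f (a *: u + v) = a *: f u + f v) ->
  (forall z, differentiable f z) -> smooth f.
Proof.
move=> fL fd vs x; set D := (X in foldr X).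
have : foldr D f vs = f \/ exists r : R, foldr D f vs = cst r.
  elim: vs => [|v vs]; first by left.
  move=> [E|[r E]]; right; rewrite /= E.
    by exists (f v); apply/funext => z; rewrite /D derive_linear.
  by exists 0; apply/funext => z; rewrite /D derive_cst.
by move=> [->|[r ->]]; [exact: fd|exact: differentiable_cst].
Qed.

Lemma alpha_primitive : primitive (ext_d (@alpha R n)) alpha.
Proof.
split => //; split => [z a u v|v].
  by rewrite /alpha gDr gZr; ring.
apply: linear_smooth => [a u w|z].
  by rewrite /alpha muliD muliZ gDl gZl /GRing.scale /=; ring.
pose f : V -> R^o := fun z => alpha z v.
have fL : linear f by move=> a u w; rewrite /f /alpha muliD muliZ gDl gZl /GRing.scale /=; ring.
pose L : {linear V -> R^o} := HB.pack f (GRing.isLinear.Build R V R^o *:%R f fL).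
apply: (@linear_differentiable _ _ _ L) => x.
apply: (@cvgMl_tmp _ _ _ _ (fun z : V => g (muli z) v)).
by apply: g_continuous; [exact: muli_continuous|exact: cvg_cst].
Qed.

(** The hemisphere is spanned by the complex line of one basis vector and a
    second basis vector; [n >= 1] provides the latter. *)
Lemma primitive_sup_norm_ge (beta : form1 R n) : (1 <= n)%N ->
  primitive (ext_d alpha) beta -> ((2^-1)%:E <= sup_norm beta)%E.
Proof.
move=> n1 bp.
have le_sup z v : sphere z -> tangent z v -> g v v <= 1 -> ((`|beta z v|)%:E <= sup_norm beta)%E.
  move=> zS zv v1; apply: (@le_trans _ _ (pointwise_norm beta z)).
    by apply: ereal_sup_ubound; exists v.
  by apply: ereal_sup_ubound; exists z.
have := le_sup (basis_vector ord0) (muli (basis_vector ord0)) (sphere_basis _) (tangent_muli _).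
rewrite g_muli2 g_basis eqxx lexx => /(_ isT).
case: (sup_norm beta) le_sup => [M| |] le_sup //= _; first last.
- by rewrite leey.
 rewrite lee_fin.
have ne : (ord0 == ord_max :> 'I_n.+1) = false by rewrite -val_eqE /= eq_sym; case: n n1.
apply: (@circle_bound R n (basis_vector ord0) (basis_vector ord_max) _ _ _ _ beta bp).
- by rewrite g_basis eqxx.
- by rewrite g_basis eqxx.
- by rewrite g_basis ne.
- exact: g_muli_basis.
- move=> z v zS zv v1; have := le_sup z v zS zv v1; rewrite lee_fin.
  by apply: le_trans; exact: ler_norm.
Qed.

Lemma mane_value_alpha : (1 <= n)%N ->
  mane_value (ext_d (@alpha R n)) = ((2^-1)%:E * sup_norm (@alpha R n) ^+ 2)%E.
Proof.
move=> n1; apply/eqP; rewrite eq_le; apply/andP; split.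
  by apply: ereal_inf_lbound; exists alpha => //; exact: alpha_primitive.
apply: le_ereal_inf_tmp => _ [beta bp <-].
have h := primitive_sup_norm_ge n1 bp.
rewrite sup_norm_alpha lee_pmul2l ?fin_numE// ?lte_fin ?invr_gt0//.
rewrite lee_sqr ?lee_fin ?invr_ge0//; apply: le_trans h; by rewrite lee_fin invr_ge0.
Qed.

End Mane.

(** * Translation invariant measure on the circle and extremal integrals *)

Section MeasureTools.
Variable R : realType.
Local Notation mu := (@lebesgue_measure R).

(** The translated measure gives each interval its length. *)
Lemma lebesgue_measure_shift (a : R) (A : set (measurableTypeR R)) : measurable A ->
  mu ((fun x => x + a) @^-1` A) = mu A.
Proof.
move=> mA.
have shE (x y : R) : (fun t => t + a) @^-1` `]x, y]%classic = `]x - a, y - a]%classic.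
  by apply/seteqP; split=> t; rewrite /= !in_itv /= ltrBlDr lerBrDr.
rewrite -[LHS]/(pushforward mu ((fun x => x + a) : _ -> measurableTypeR R) A).
apply/esym/lebesgue_measure_unique => //=.
  by apply: measurable_funD; [exact: measurable_id|exact: measurable_cst].
move=> ms _ [[x y]] _ <-.
rewrite /pushforward shE !lebesgue_measure_itv /= !lte_fin ltrD2r.
by case: ifPn => // _; rewrite -!EFinB; congr EFin; ring.
Qed.

(** Lebesgue measure on [[0, 1[], as a measure on the line: for sets of period 1
    it plays the part of the uniform measure on the circle. *)
Definition unit_prob : set (measurableTypeR R) -> \bar R :=
  mrestr mu (measurable_itv `[(0 : R), 1[).

HB.instance Definition _ := Measure.on unit_prob.

Let unit_probT : unit_prob [set: _] = 1%E.
Proof.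
by rewrite /unit_prob /mrestr setTI lebesgue_measure_itv /= lte_fin ltr01 oppr0 adde0.
Qed.

HB.instance Definition _ := @Measure_isProbability.Build _ _ R unit_prob unit_probT.

(** Reduce to a translation by [f] in [[0, 1[]: it moves [[0, 1[] to
    [[f, 1 + f[], and by periodicity the part of the set in [[1, 1 + f[] can be
    brought back to [[0, f[]. *)
Lemma unit_prob_shift (S : set (measurableTypeR R)) (a : R) : measurable S ->
  (forall x, S (x + 1) <-> S x) -> unit_prob ((fun x => x + a) @^-1` S) = unit_prob S.
Proof.
move=> mS S1.
have Sn (j : nat) x : S (x + j%:R) <-> S x.
  by elim: j => [|j IH]; rewrite ?addr0// -natr1 addrA S1.
have Sz (m : int) x : S (x + m%:~R) <-> S x.
  case: m => j; first exact: Sn.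
  by rewrite NegzE mulrNz -[in X in _ <-> X](subrK (j.+1%:R) x) Sn.
pose N := Num.floor a; pose f := a - N%:~R.
have /andP[N1 N2] : N%:~R <= a < (N + 1)%:~R by exact: floor_itv.
have f0 : 0 <= f by rewrite subr_ge0.
have f1 : f < 1 by rewrite ltrBlDr addrC -intrD1.
have -> : (fun x => x + a) @^-1` S = (fun x => x + f) @^-1` S.
  apply/seteqP; split=> x /=; rewrite -(Sz N (x + f)) /f -addrA subrK //.
rewrite /unit_prob /mrestr.
have mitv (u v : R) : measurable (`[u, v[%classic : set
  (measurableTypeR R)) by exact: measurable_itv.
have -> : (fun x => x + f) @^-1` S `&` `[0, 1[ = (fun x => x + f) @^-1` (S `&` `[f, 1 + f[).
  by apply/seteqP; split=> x /=; rewrite !in_itv /= lerDr ltrD2r.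
rewrite lebesgue_measure_shift; last exact: measurableI.
have -> : S `&` `[f, 1 + f[ = (S `&` `[f, 1[) `|` (S `&` `[1, 1 + f[).
  rewrite -setIUr; congr (_ `&` _); apply/seteqP; split=> x /=; rewrite !in_itv /=.
    by move=> /andP[h1 h2]; case: (ltP x 1) => h; [left|right]; rewrite ?h1 ?h2.
  by move=> [/andP[h1 h2]|/andP[h1 h2]]; apply/andP; split; lra.
have -> : S `&` `[0, 1[ = (S `&` `[f, 1[) `|` (S `&` `[0, f[).
  rewrite -setIUr; congr (_ `&` _); apply/seteqP; split=> x /=; rewrite !in_itv /=.
    by move=> /andP[h1 h2]; case: (leP f x) => h; [left|right]; rewrite ?h1 ?h2.
  by move=> [/andP[h1 h2]|/andP[h1 h2]]; apply/andP; split; lra.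
rewrite !measureU//; try exact: measurableI; first last.
- by apply/seteqP; split=> x //= [[_ +] [_]]; rewrite /= !in_itv /=; lra.
- by apply/seteqP; split=> x //= [[_ +] [_]]; rewrite /= !in_itv /=; lra.
congr (_ + _)%E.
have mS1 : measurable (S `&` `[1, 1 + f[) by exact: measurableI.
transitivity (mu ((fun x => x + 1) @^-1` (S `&` `[1, 1 + f[))).
  exact/esym/(lebesgue_measure_shift 1 mS1).
congr (mu _); apply/seteqP; split=> x /= [h hx]; (split; first exact/S1);
  move: hx; rewrite !in_itv /=; lra.
Qed.

End MeasureTools.

Section IntegralBounds.
Context d (T : measurableType d) (R : realType) (nu : {measure set T -> \bar R}).
Variables (D : set T) (f : T -> R) (c : R).
Hypotheses (mD : measurable D) (nuD : nu D = 1%E) (mf : measurable_fun D f)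
  (c0 : 0 <= c) (fge : forall x, D x -> - c <= f x).

Local Notation F := (EFin \o f).

Let mF : measurable_fun D F. Proof. exact/measurable_EFinP. Qed.

Let neg_le : (\int[nu]_(x in D) F^\- x <= c%:E)%E.
Proof.
have -> : c%:E = (\int[nu]_(x in D) c%:E)%E by rewrite integral_cst// nuD mule1.
apply: ge0_le_integral => //.
- exact: measurable_funeneg.
- move=> x Dx; rewrite funenegE /= ge_max !lee_fin c0 andbT.
  by have := fge Dx; lra.
Qed.

(** For a real function bounded below this holds even if its integral is
    infinite. *)
Lemma integral_lower_bound : ((- c)%:E <= \int[nu]_(x in D) (f x)%:E)%E.
Proof.
rewrite [leRHS]integralE -[(- c)%:E]add0e EFinN; apply: leeD.
  by apply: integral_ge0 => x Dx; rewrite funeposE le_max lexx orbT.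
by rewrite leeN2.
Qed.

(** The hypothesis makes [f] integrable; then [f + c] is nonnegative with
    integral 0, hence vanishes almost everywhere. *)
Lemma integral_lower_bound_attained :
  (\int[nu]_(x in D) (f x)%:E <= (- c)%:E)%E -> nu (D `&` [set x | f x != - c]) = 0%E.
Proof.
rewrite [leLHS]integralE => h.
have p0 : (0 <= \int[nu]_(x in D) F^\+ x)%E.
  by apply: integral_ge0 => x Dx; rewrite funeposE le_max lexx orbT.
have n0 : (0 <= \int[nu]_(x in D) F^\- x)%E.
  by apply: integral_ge0 => x Dx; rewrite funenegE le_max lexx orbT.
have nfin : (\int[nu]_(x in D) F^\- x)%E \is a fin_num.
  by rewrite ge0_fin_numE// (le_lt_trans neg_le)// ltry.
have pfin : (\int[nu]_(x in D) F^\+ x < +oo)%E.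
  move: h; rewrite leeBlDr// => /le_lt_trans; apply.
  by rewrite -(fineK nfin) -EFinD ltry.
have intF : nu.-integrable D F.
  apply/integrableP; split => //.
  rewrite -[fun x => _]/(abse \o F) fune_abse ge0_integralD//; first last.
  - exact: measurable_funeneg.
  - exact: measurable_funepos.
  by rewrite lte_add_pinfty// (le_lt_trans neg_le)// ltry.
have intc : nu.-integrable D (EFin \o cst c).
  apply/integrableP; split; first exact/measurable_EFinP/measurable_cst.
  by rewrite (integral_cst nu mD `|c%:E|%E) nuD mule1 ltry.
have I0 : (\int[nu]_(x in D) `| (f x + c)%:E | = 0)%E.
  apply/eqP; rewrite eq_le integral_ge0// andbT.
  have -> : (\int[nu]_(x in D) `| (f x + c)%:E | = \int[nu]_(x in D) ((f x)%:E + c%:E))%E.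
    apply: eq_integral => x /set_mem Dx; rewrite -EFinD gee0_abs// lee_fin.
    by have := fge Dx; lra.
  rewrite (integralD mD intF intc) /= integral_cst// nuD mule1.
  by rewrite -(@leeBrDr _ _ _ (c%:E))// sub0e -EFinN integralE.
have mfc : measurable_fun D (fun x => (f x + c)%:E).
  by apply/measurable_EFinP; apply: measurable_funD => //; exact: measurable_cst.
have := (ae_eq_integral_abs nu mD mfc).1 I0.
move=> [N [mN N0 sub]]; apply/eqP; rewrite -measure_le0 -N0.
have mne : measurable (D `&` [set x | f x != - c]).
  have -> : D `&` [set x | f x != - c] = D `&` f @^-1` (~` [set - c]).
    by apply/seteqP; split=> x [Dx /= /eqP h1]; split => //; apply/eqP.
  by apply: mf => //; apply: measurableC; exact: measurable_set1.
apply: le_measure; rewrite ?inE// => x [Dx /= fx]; apply: sub => /= /(_ Dx) [] e.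
by move/eqP: fx; apply; lra.
Qed.

End IntegralBounds.

(** * The Mather set *)

Section Mather.
Variables (R : realType) (n : nat).
Local Notation V := (Cspace R n).
Local Notation TV := (borel_TV R n).
Implicit Types (z q v : V) (t x : R).

Lemma borel_open (A : set (V * V)) : open A -> measurable (A : set TV).
Proof. by move=> oA; exact: sub_sigma_algebra. Qed.

Lemma borel_closed (A : set (V * V)) : closed A -> measurable (A : set TV).
Proof.
move=> cA; rewrite -[A]setCK; apply: measurableC.
by apply: borel_open; exact: closed_openC.
Qed.

Lemma borel_continuous (f : V * V -> R) : continuous f ->
  measurable_fun [set: TV] (f : TV -> measurableTypeR R).
Proof.
move=> cf; apply: (measurability _ (RGenOInfty.measurableE R)).
move=> _ [_ [x ->] <-]; rewrite setTI; apply: borel_open.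
by apply: open_comp => [w _|]; [exact: cf|exact: interval_open].
Qed.

Lemma continuous_borel (c : R -> V * V) : continuous c ->
  measurable_fun [set: measurableTypeR R] (c : measurableTypeR R -> TV).
Proof.
move=> cc; apply: (@measurability _ _ (measurableTypeR R) TV setT c (@open (V * V)%type) erefl).
move=> _ [A oA <-]; rewrite setTI; apply: open_measurable.
by apply: open_comp => // x _; exact: cc.
Qed.

(** A quarter of the Reeb vector at [z] is [i z / 2]. *)
Definition reeb_lift z : V * V := (z, 2^-1 *: muli z).

Lemma reeb_liftE z : reeb_lift z = (z, (4^-1 : R) *: reeb z).
Proof. by rewrite /reeb_lift /reeb scalerA; congr (_, _ *: _); field. Qed.

(** Completing the square; [alpha] is the product with [i q / 2], whose half
    squared norm is [1/8]. *)
Lemma lagrangianE q v : sphere q ->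
  lagrangian alpha (q, v) = 2^-1 * g (v - 2^-1 *: muli q) (v - 2^-1 *: muli q) - 8^-1.
Proof.
by move=> /sphereE q1; rewrite /lagrangian /alpha /= !g_linE (gC v) q1; field.
Qed.

Lemma lagrangian_ge (w : V * V) : tangent_bundle w -> - 8^-1 <= lagrangian alpha w.
Proof.
case: w => q v [/= qS _]; rewrite lagrangianE// lerBrDr addNr.
by rewrite mulr_ge0 ?invr_ge0// g_ge0.
Qed.

Lemma lagrangian_eq (w : V * V) : tangent_bundle w ->
  lagrangian alpha w = - 8^-1 -> w = reeb_lift w.1.
Proof.
case: w => q v [/= qS _]; rewrite lagrangianE// => h.
congr pair; apply/eqP; rewrite -subr_eq0; apply/eqP; apply: g_eq0; lra.
Qed.

Lemma lagrangian_reeb z : sphere z -> lagrangian alpha (reeb_lift z) = - 8^-1.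
Proof. by move=> zS; rewrite lagrangianE// subrr g0l mulr0 sub0r. Qed.

Lemma reeb_lift_bundle z : sphere z -> tangent_bundle (reeb_lift z).
Proof. by move=> zS; split => //=; rewrite /tangent /= gZr g_muli_r mulr0. Qed.

Let fst_cont (w : V * V) : {for w, continuous (fst : V * V -> V)}. Proof. exact: cvg_fst. Qed.
Let snd_cont (w : V * V) : {for w, continuous (snd : V * V -> V)}. Proof. exact: cvg_snd. Qed.
Let Jfst_cont (w : V * V) : {for w, continuous (fun w : V * V => muli w.1)}.
Proof.
exact: (@continuous_comp _ _ _ (fst : V * V -> V) (@muli R n) w
  (@fst_cont w) (@muli_continuous R n w.1)).
Qed.

Lemma lagrangian_continuous : continuous (lagrangian alpha : V * V -> R).
Proof.
move=> w; apply: cvgB; apply: cvgMl_tmp.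
  by apply: (@g_continuous _ _ _ snd snd); exact: snd_cont.
apply: (@g_continuous _ _ _ (fun w => muli w.1) snd); last exact: snd_cont.
exact: Jfst_cont.
Qed.

Lemma zero_set_closed (f : V * V -> R) : continuous f -> closed [set w | f w = 0].
Proof.
move=> cf; have -> : [set w | f w = 0] = f @^-1` [set 0] by [].
apply: closed_comp; [by move=> w _; exact: cf|exact: closed_eq].
Qed.

Lemma tangent_bundle_closed : closed (@tangent_bundle R n).
Proof.
have -> : @tangent_bundle R n = [set w | g w.1 w.1 - 1 = 0] `&` [set w | g w.1 w.2 = 0].
  apply/seteqP; split=> w [h1 h2]; split=> //.
    by rewrite /= (sphereE _).1// subrr.
  by apply/sphereE/eqP; rewrite -subr_eq0; apply/eqP.
apply: closedI; apply: zero_set_closed => w.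
  apply: cvgB; last exact: cvg_cst.
  by apply: (@g_continuous _ _ _ fst fst); exact: fst_cont.
by apply: (@g_continuous _ _ _ fst snd); [exact: fst_cont|exact: snd_cont].
Qed.

Definition reeb_section : set (V * V) := [set reeb_lift z | z in sphere].

Lemma reeb_section_closed : closed reeb_section.
Proof.
have -> : reeb_section = [set w | g w.1 w.1 - 1 = 0] `&`
    [set w : V * V | g (w.2 - 2^-1 *: muli w.1) (w.2 - 2^-1 *: muli w.1) = 0].
  apply/seteqP; split=> [_ [z zS <-]|[q v] [h1 /= /g_eq0 h2]].
    by split; rewrite /= ?subrr ?g0l// (sphereE _).1// subrr.
  exists q; first by apply/sphereE/eqP; rewrite -subr_eq0; apply/eqP.
  by congr pair; apply/eqP; rewrite eq_sym -subr_eq0; apply/eqP.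
apply: closedI; apply: zero_set_closed => w.
  apply: cvgB; last exact: cvg_cst.
  by apply: (@g_continuous _ _ _ fst fst); exact: fst_cont.
have c : {for w, continuous (fun w : V * V => w.2 - 2^-1 *: muli w.1)}.
  by apply: cvgB; [exact: snd_cont|apply: cvgZl_tmp; exact: Jfst_cont].
exact: (@g_continuous _ _ _ _ _ _ c c).
Qed.

Lemma crot_continuous (a : R) z : continuous (fun x : R => crot (a * x) z).
Proof.
move=> x; apply: differentiable_continuous; apply/derivable1_diffP.
exact: (@ex_derive _ _ _ _ _ _ _ (is_derive_crot a x z)).
Qed.

(** The lift of the Reeb orbit through [z] to the tangent bundle, parametrized
    with period 1. *)
Definition reeb_orbit z x : V * V := reeb_lift (crot (pi *+ 2 * x) z).

Lemma reeb_orbit_continuous z : continuous (reeb_orbit z).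
Proof.
move=> x; apply: (@cvg_pair _ _ _ _ (nbhs (crot (pi *+ 2 * x) z)) (nbhs (2^-1 *: muli
  (crot (pi *+ 2 * x) z)))).
  exact: crot_continuous.
apply: cvgZl_tmp.
exact: (continuous_comp (@crot_continuous (pi *+ 2) z x) (@muli_continuous R n _)).
Qed.

Lemma sphere_crot x z : sphere z -> sphere (crot x z).
Proof. by move=> /sphereE z1; apply/sphereE; rewrite g_crot. Qed.

Lemma reeb_orbitD1 z x : reeb_orbit z (x + 1) = reeb_orbit z x.
Proof.
by rewrite /reeb_orbit; congr reeb_lift; rewrite mulrDr mulr1 !crotE cosD2pi sinD2pi.
Qed.

Lemma reeb_geodesic z : sphere z ->
  magnetic_geodesic (ext_d alpha) (twofreq 2^-1 2^-1 z 0).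
Proof.
move=> /sphereE z1; have J0 : muli (0 : V) = 0 by rewrite /muli /= oppr0.
have [||||geo _] := @twofreq_geodesic R n 2^-1 2^-1 z 0.
- by field.
- by rewrite g0r addr0.
- exact: g0r.
- by rewrite J0 g0r.
- exact: geo.
Qed.

Lemma reeb_lift_flow z t : sphere z ->
  (twofreq 2^-1 2^-1 z 0 t, derive1 (twofreq 2^-1 2^-1 z 0) t) = reeb_lift (crot (2^-1 * t) z).
Proof.
move=> zS; have J0 : muli (0 : V) = 0 by rewrite /muli /= oppr0.
by rewrite derive1_twofreq /twofreq J0 scaler0 !crot_zero !addr0 crotZ crot_muli.
Qed.

(** On the lift of a Reeb orbit the flow is the rotation by [t / 2]; uniqueness
    of geodesics is needed because [flow_preimage] quantifies over all geodesics
    with the given initial data. *)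
Lemma flow_preimage_reeb z t (A : set (V * V)) : sphere z ->
  flow_preimage (ext_d alpha) t A (reeb_lift z) <-> A (reeb_lift (crot (2^-1 * t) z)).
Proof.
move=> zS; have e0 := reeb_lift_flow 0 zS; rewrite mulr0 crot0 in e0.
split=> [[c [geo cE Ac]]|Az].
  have -> : reeb_lift (crot (2^-1 * t) z) = (c t, derive1 c t) => //.
  have [cE0 cE1] : c 0 = z /\ derive1 c 0 = 2^-1 *: muli z by case: cE.
  have [fE0 fE1] := e0.
  have -> : c = twofreq 2^-1 2^-1 z 0.
    apply: (geodesic_unique geo (reeb_geodesic zS)); first by rewrite cE0 fE0.
    by rewrite cE1 fE1.
  by rewrite reeb_lift_flow.
exists (twofreq 2^-1 2^-1 z 0); split; [exact: reeb_geodesic|exact: e0|].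
by rewrite reeb_lift_flow.
Qed.

Definition reeb_rv z : {mfun measurableTypeR R >-> TV} :=
  mfun_Sub (mem_set (continuous_borel (@reeb_orbit_continuous z))).

(** The uniform probability measure on the lift of the Reeb orbit through [z]. *)
Definition reeb_measure z : probability TV R := distribution (@unit_prob R) (reeb_rv z).

Lemma reeb_measureE z (A : set TV) : reeb_measure z A = unit_prob (reeb_orbit z @^-1` A).
Proof. by []. Qed.

Lemma reeb_measure_bundle z : sphere z -> reeb_measure z (@tangent_bundle R n) = 1%E.
Proof.
move=> zS; rewrite reeb_measureE.
have -> : reeb_orbit z @^-1` (@tangent_bundle R n) = setT.
  by apply/seteqP; split=> // x _; apply: reeb_lift_bundle; exact: sphere_crot.
exact: probability_setT.
Qed.

(** The orbit has period [4 pi] under the flow, so the flow at time [t] shifts the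
    parameter of [reeb_orbit] by [t / (4 pi)], and [unit_prob] is invariant under
    shifts of periodic sets. *)
Lemma reeb_measure_invariant z : sphere z ->
  invariant_probability (ext_d alpha) (reeb_measure z).
Proof.
move=> zS; split; first exact: reeb_measure_bundle.
move=> t A mA; rewrite !reeb_measureE.
have mS : measurable (reeb_orbit z @^-1` A : set (measurableTypeR R)).
  by rewrite -[X in measurable X]setTI; exact: (continuous_borel (@reeb_orbit_continuous z)).
rewrite -(@unit_prob_shift _ _ (t / (pi *+ 4)) mS) => [|x]; last first.
  by rewrite /= reeb_orbitD1.
have shE x : crot (2^-1 * t) (crot (pi *+ 2 * x) z) = crot (pi *+ 2 * (x + t / (pi *+ 4))) z.
  rewrite crotK; congr crot; move: (pi_gt0 R); move: (pi : R) => p p0.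
  have p4 : p != 0 by rewrite gt_eqF.
  by field.
suff -> : reeb_orbit z @^-1` flow_preimage (ext_d alpha) t A =
    +%R^~ (t / (pi *+ 4)) @^-1` (reeb_orbit z @^-1` A) by [].
apply/seteqP; split=> x.
  by move=> /(flow_preimage_reeb _ _ (sphere_crot _ zS)); rewrite shE.
by move=> h; apply/(flow_preimage_reeb _ _ (sphere_crot _ zS)); rewrite shE.
Qed.

Lemma reeb_measure_action z : sphere z -> action alpha (reeb_measure z) = (- 8^-1)%:E.
Proof.
move=> zS; have zT := reeb_measure_bundle zS.
have mT : measurable (@tangent_bundle R n : set TV).
  exact: borel_closed (@tangent_bundle_closed).
have LE : (EFin \o lagrangian alpha) \o reeb_rv z = cst (- 8^-1)%:E.
  by apply/funext => x; rewrite /= lagrangian_reeb//; exact: sphere_crot.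
have TE : reeb_rv z @^-1` (@tangent_bundle R n) = setT.
  by apply/seteqP; split=> // x _; apply: reeb_lift_bundle; exact: sphere_crot.
have mF : measurable_fun [set: TV] (EFin \o (lagrangian alpha : TV -> R)).
  by apply/measurable_EFinP; exact: borel_continuous lagrangian_continuous.
have intF : (@unit_prob R).-integrable (reeb_rv z @^-1` (@tangent_bundle R n))
    ((EFin \o lagrangian alpha) \o reeb_rv z).
  by rewrite LE TE; exact: (finite_measure_integrable_cst _ (- 8^-1)).
have h := integral_pushforward (measurable_funPT (reeb_rv z)) mF intF mT.
by rewrite /action [LHS]h LE TE integral_cst//
  [X in (_ * X)%E](@probability_setT _ _ _ (@unit_prob R)) mule1.
Qed.

Lemma measurable_lagrangian : measurable_fun (@tangent_bundle R n : set TV)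
  (lagrangian alpha : TV -> R).
Proof. exact: measurable_funTS (borel_continuous lagrangian_continuous). Qed.

(** The Lagrangian is constantly equal to its minimum on the lift of the orbit. *)
Lemma reeb_measure_minimizing z : sphere z -> minimizing_measure alpha (reeb_measure z).
Proof.
move=> zS; split; first exact: reeb_measure_invariant.
move=> nu [nuT _]; rewrite reeb_measure_action//.
apply: integral_lower_bound => //.
- exact: borel_closed (@tangent_bundle_closed).
- exact: measurable_lagrangian.
- exact: lagrangian_ge.
Qed.

Lemma reeb_measure_support z : measure_support (reeb_measure z) (reeb_lift z).
Proof.
move=> U oU Uz; rewrite reeb_measureE.
have oV : open (reeb_orbit z @^-1` U).
  by apply: open_comp => // x _; exact: reeb_orbit_continuous.
have : nbhs (0 : R) (reeb_orbit z @^-1` U).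
  by apply: open_nbhs_nbhs; split => //=; rewrite /reeb_orbit mulr0 crot0.
move=> /nbhs_ballP [e /= e0 sub].
pose d := Num.min e 1.
have d0 : 0 < d by rewrite lt_min e0 ltr01.
have mV : measurable (reeb_orbit z @^-1` U : set (measurableTypeR R)) by exact: open_measurable.
have le : (@lebesgue_measure R `[0%R, d[%classic <= unit_prob (reeb_orbit z @^-1` U))%E.
  apply: le_measure; rewrite ?inE.
  - exact: measurable_itv.
  - by apply: measurableI => //; exact: measurable_itv.
  - move=> x /=; rewrite !in_itv /= lt_min => /andP[x0 /andP[xe x1]]; split; last by rewrite x0.
    by apply: sub; rewrite /ball /= sub0r normrN ger0_norm.
apply: lt_le_trans le; rewrite lebesgue_measure_itv /= lte_fin d0 oppr0 adde0 lte_fin //.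
Qed.

(** The Reeb measure of [z] bounds the minimal action above by [- 1/8].  So the
    Lagrangian of a minimizing measure equals [- 1/8] almost everywhere, and the
    complement of the closed set [reeb_section] is an open null set. *)
Lemma minimizing_support (mu : probability TV R) (w : V * V) (z : V) : sphere z ->
  minimizing_measure alpha mu -> measure_support mu w -> reeb_section w.
Proof.
move=> zS [[muT _] mumin] sw.
have mT : measurable (@tangent_bundle R n : set TV).
  exact: borel_closed (@tangent_bundle_closed).
have h : (action alpha mu <= (- 8^-1)%:E)%E.
  by rewrite -(reeb_measure_action zS); apply: mumin; exact: reeb_measure_invariant.
have N0 := integral_lower_bound_attained mT muT measurable_lagrangian _ lagrangian_ge h.
apply: contrapT => nw.
have oC : open (~` reeb_section) by exact: closed_openC reeb_section_closed.
have := sw _ oC nw; rewrite ltNge => /negP; apply.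
have muTc : mu (~` (@tangent_bundle R n)) = 0%E.
  by rewrite probability_setC// muT subee.
have mneq : measurable (@tangent_bundle R n `&` [set w | lagrangian alpha w != - 8^-1] : set TV).
  have -> : @tangent_bundle R n `&` [set w | lagrangian alpha w != - 8^-1] =
      @tangent_bundle R n `&` lagrangian alpha @^-1` (~` [set - 8^-1]).
    by apply/seteqP; split=> x [Dx /= /eqP h1]; split => //; apply/eqP.
  by apply: measurable_lagrangian => //; apply: measurableC; exact: measurable_set1.
apply: (@le_trans _ _ (mu ((~` (@tangent_bundle R n)) `|`
   (@tangent_bundle R n `&` [set w | lagrangian alpha w != - 8^-1])))).
  apply: le_measure; rewrite ?inE.
  - exact: borel_open.
  - by apply: measurableU => //; exact: measurableC.
  - move=> x nx; have [Tx|Tx] := pselect (tangent_bundle x); last by left.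
    right; split => //=; apply/eqP => Lx; apply: nx.
    by rewrite (lagrangian_eq Tx Lx); exists x.1 => //; case: Tx.
apply: le_trans (measureU2 _ _ _) _ => //; first exact: measurableC.
by rewrite [X in (X + _)%E]muTc add0e [leLHS]N0.
Qed.

Lemma mather_set_alpha :
  mather_set (@alpha R n) = [set (z, (4^-1 : R) *: reeb z) | z in sphere].
Proof.
apply/seteqP; split=> [w [mu mumin sw]|_ [z zS <-]]; last first.
  rewrite -reeb_liftE; exists (reeb_measure z); first exact: reeb_measure_minimizing.
  exact: reeb_measure_support.
have [z zS <-] := minimizing_support (sphere_basis R ord0) mumin sw.
by exists z => //; rewrite reeb_liftE.
Qed.

End Mather.

(** * The theorem *)

Theorem theorem1p1 (R : realType) :
  (forall n : nat, (1 <= n)%N ->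
    [/\ mane_value (ext_d (@alpha R n)) =
          ((2^-1)%:E * sup_norm (@alpha R n) ^+ 2)%E,
        ((2^-1)%:E * sup_norm (@alpha R n) ^+ 2)%E = (8^-1)%:E,
        mather_set (@alpha R n) =
          [set (z, (4^-1 : R) *: reeb z) | z in sphere] &
        forall q0 q1 : Cspace R n, sphere q0 -> sphere q1 ->
          (forall k : R, 8^-1 < k -> connecting_geodesics k q0 q1 !=set0) /\
          (connecting_geodesics (8^-1) q0 q1 !=set0 <-> hdot q0 q1 <> 0)]) /\
  (forall k : R, 0 < k -> k < 8^-1 ->
    exists a b : R, 0 < b /\
      forall n : nat, (1 <= n)%N ->
      forall q0 q1 : Cspace R n, sphere q0 -> sphere q1 ->
        [/\ ((Num.sqrt (1 - 8 * k))%:C < `|hdot q0 q1| ->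
               connecting_geodesics k q0 q1 !=set0),
            (`|hdot q0 q1| = (Num.sqrt (1 - 8 * k))%:C ->
               (connecting_geodesics k q0 q1 !=set0 <->
                exists m : int, hdot q0 q1 =
                  expi (a + m%:~R * b) * (Num.sqrt (1 - 8 * k))%:C)) &
            (`|hdot q0 q1| < (Num.sqrt (1 - 8 * k))%:C ->
               connecting_geodesics k q0 q1 = set0)]).
Proof.
split=> [n n1|k k0 k8].
  split; [exact: mane_value_alpha|exact: half_sup_norm_alpha|exact: mather_set_alpha|].
  move=> q0 q1 q0S q1S; split=> [k hk|]; last exact: connecting_critical.
  have sq0 := sqnorm_ge0 (hdot q0 q1).
  by apply: connecting_exists => //; [lra|lra|right].
exists (shift_a k), (shift_b k); split; first exact: shift_b_gt0.
by move=> n n1 q0 q1 q0S q1S; exact: connecting_subcritical.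
Qed.
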